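(* There is no $\mathsf{WRP}$ map $T\colon\{U,D\}^*\rightharpoonup\{U,D\}^*$ that is defined on every Dyck path, sends every Dyck path $P$ to a Dyck path of the same semilength, and satisfies $$\operatorname{area}(T(P))=\operatorname{dinv}(P)\quad\text{and}\quad\operatorname{dinv}(T(P))=\operatorname{area}(P)\qquad\text{for every }P\in\mathcal D.$$
   Context: **Dyck paths.** A Dyck path of semilength $n$ is a word $P\in\{U,D\}^{2n}$ with $n$ letters $U$ and $n$ letters $D$ such that every prefix has at least as many $U$'s as $D$'s. $\mathcal D_n$ is the set of these, $\mathcal D=\bigcup_{n\ge0}\mathcal D_n$. For a word $w\in\{U,D\}^*$, $h_w(k)$ is the number of $U$'s minus the number of $D$'s among its first $k$ letters. If $P\in\mathcal D_n$ has its $U$'s at positions $p_1<\dots<p_n$, its area sequence is $(a_1,\dots,a_n)$ with $a_i=h_P(p_i-1)$. Then $\operatorname{area}(P)=\sum_i a_i$ and $\operatorname{dinv}(P)=|\{(i,j):1\le i<j\le n,\ a_i-a_j\in\{0,1\}\}|$. **MSO on words.** A word $w=a_1\cdots a_n$ over a finite alphabet $\Sigma$ is a structure with universe $\mathrm{Pos}(w)=\{1,\dots,n\}$, the order $<$, and unary predicates $P_a$ ($a\in\Sigma$) with $P_a(i)$ iff $a_i=a$. MSO formulas are built from $x<y$, $x=y$, $P_a(x)$, $x\in X$ by Boolean connectives and quantification over positions and over sets of positions. $w\models\varphi(i_1,\dots,i_k)$ denotes satisfaction. **Polyregular presentations.** A polyregular presentation (input alphabet $\Sigma$, output alphabet $\Gamma$,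 both finite) consists of: a nonempty finite set $C$ of copy names, each $c\in C$ with an arity $k_c\ge1$; an MSO domain sentence $\varphi_{\mathrm{dom}}$; for each $c$ an MSO selection formula $\varphi_c(x_1,\dots,x_{k_c})$, giving the set of selected atoms $\mathrm{At}(w)=\{(c,\bar i):c\in C,\ \bar i\in\mathrm{Pos}(w)^{k_c},\ w\models\varphi_c(\bar i)\}$; for each $c$ and $\gamma\in\Gamma$ an MSO label formula $\psi_{c,\gamma}(x_1,\dots,x_{k_c})$ such that each selected atom $(c,\bar i)$ satisfies exactly one of them, that $\gamma$ being its label; and for each pair $c,c'\in C$ an MSO ordering formula $\chi_{c,c'}(\bar x,\bar y)$, such that on each $w$ these define a strict linear order $\chi$ on $\mathrm{At}(w)$. **Rank functions.** A $d$-dimensional deterministic additive rank source over $\Sigma$ is $A=(Q,q_0,\delta,\omega)$ with $Q$ a finite set, $q_0\in Q$, $\delta\colon Q\times\Sigma\to Q$, $\omega\colon Q\times\Sigma\to\mathbb Z^d$. On $w=a_1\cdots a_n$ put $q_i=\delta(q_{i-1},a_i)$; for $1\le i\le n+1$ the prefix rank is $\rho_A^w(i)=\sum_{j<i}\omega(q_{j-1},a_j)$, and $q^A_i:=q_{i-1}$ is the state just before position $i$. A $d$-dimensional prefix-additive rank function on $k$-tuples of positions is a function of the form $\kappa^w(x_1,\dots,x_k)=c_0+\sum_{r=1}^k\bigl(\rho_{A_r}^w(x_r)+\beta_r(q^{A_r}_{x_r},a_{x_r})\bigr)$, with $c_0\in\mathbb Z^d$ fixed, $A_r$ fixed $d$-dimensional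 rank sources with state sets $Q_r$, and $\beta_r\colon Q_r\times\Sigma\to\mathbb Z^d$ fixed tables. **WRP.** A $\mathsf{WRP}$ presentation is a polyregular presentation together with a fixed $d\ge0$ and, for each $c\in C$, a $d$-dimensional prefix-additive rank function $\kappa_c$ on $k_c$-tuples. Selected atoms are ordered by $(c,\bar i)\prec(c',\bar i')$ iff $\kappa_c^w(\bar i)<_{\mathrm{lex}}\kappa_{c'}^w(\bar i')$, or these vectors are equal and $(c,\bar i)$ precedes $(c',\bar i')$ in $\chi$. The associated partial map $T\colon\Sigma^*\rightharpoonup\Gamma^*$ has domain $\{w:w\models\varphi_{\mathrm{dom}}\}$, and $T(w)$ is the concatenation of the labels of the selected atoms in increasing $\prec$-order. $\mathsf{WRP}$ is the class of partial maps so obtained. *)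

(* Defs.v *)
From HB Require Import structures.
From mathcomp Require Import all_boot all_order all_algebra.

Set Implicit Arguments.
Unset Strict Implicit.
Unset Printing Implicit Defensive.

Import Order.TTheory GRing.Theory Num.Theory.
Local Open Scope ring_scope.

Variant step := U | D.

Definition bool_of_step (s : step) : bool := if s is U then true else false.
Definition step_of_bool (b : bool) : step := if b then U else D.
Lemma bool_of_stepK : cancel bool_of_step step_of_bool. Proof. by case. Qed.

HB.instance Definition _ := Finite.copy step (can_type bool_of_stepK).

Definition height (w : seq step) (k : nat) : int :=
  (count_mem U (take k w))%:Z - (count_mem D (take k w))%:Z.

Definition dyck (n : nat) (P : seq step) : Prop :=
  [/\ size P = n.*2, count_mem U P = n, count_mem D P = n &
      forall k : nat, (count_mem D (take k P) <= count_mem U (take k P))%N].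

(* Positions are numbered from 0, so [height P i] is the height just before
   the letter in position [i]. *)
Definition area_seq (P : seq step) : seq int :=
  [seq height P i | i <- iota 0 (size P) & nth D P i == U].

Definition area (P : seq step) : int := \sum_(a <- area_seq P) a.

Definition dinv (P : seq step) : nat :=
  let a := area_seq P in
  #|[set ij : 'I_(size a) * 'I_(size a) |
      (ij.1 < ij.2)%N && (a`_(ij.1) - a`_(ij.2) \in [:: 0; 1])]|.

Notation pos w := 'I_(size w).

Definition letter (Sigma : finType) (w : seq Sigma) (i : pos w) : Sigma :=
  tnth (in_tuple w) i.

(* [mso Sigma k m] is the type of formulas with free position variables among
   0, ..., k-1 and free set variables among 0, ..., m-1. Variables are de Bruijn
   indices: a quantifier binds variable 0 of its body and shifts the others. *)
Inductive mso (Sigma : Type) : nat -> nat -> Type :=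
| MLt k m of 'I_k & 'I_k : mso Sigma k m
| MEq k m of 'I_k & 'I_k : mso Sigma k m
| MLetter k m of Sigma & 'I_k : mso Sigma k m
| MMem k m of 'I_k & 'I_m : mso Sigma k m
| MNot k m of mso Sigma k m : mso Sigma k m
| MAnd k m of mso Sigma k m & mso Sigma k m : mso Sigma k m
| MOr k m of mso Sigma k m & mso Sigma k m : mso Sigma k m
| MExPos k m of mso Sigma k.+1 m : mso Sigma k m
| MAllPos k m of mso Sigma k.+1 m : mso Sigma k m
| MExSet k m of mso Sigma k m.+1 : mso Sigma k m
| MAllSet k m of mso Sigma k m.+1 : mso Sigma k m.

Fixpoint sat (Sigma : finType) (w : seq Sigma) (k m : nat)
    (phi : mso Sigma k m) {struct phi} :
    k.-tuple (pos w) -> m.-tuple {set pos w} -> bool :=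
  match phi in mso _ k m
    return k.-tuple (pos w) -> m.-tuple {set pos w} -> bool with
  | MLt _ _ x y => fun e _ => (tnth e x < tnth e y)%N
  | MEq _ _ x y => fun e _ => tnth e x == tnth e y
  | MLetter _ _ a x => fun e _ => letter (tnth e x) == a
  | MMem _ _ x X => fun e E => tnth e x \in tnth E X
  | MNot _ _ f => fun e E => ~~ sat f e E
  | MAnd _ _ f g => fun e E => sat f e E && sat g e E
  | MOr _ _ f g => fun e E => sat f e E || sat g e E
  | MExPos _ _ f => fun e E => [exists i : pos w, sat f (cons_tuple i e) E]
  | MAllPos _ _ f => fun e E => [forall i : pos w, sat f (cons_tuple i e) E]
  | MExSet _ _ f =>
      fun e E => [exists I : {set pos w}, sat f e (cons_tuple I E)]
  | MAllSet _ _ f =>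
      fun e E => [forall I : {set pos w}, sat f e (cons_tuple I E)]
  end.

Definition models (Sigma : finType) (w : seq Sigma) (k : nat)
    (phi : mso Sigma k 0) (x : k.-tuple (pos w)) : bool :=
  sat phi x [tuple].

Record polyreg_data (Sigma Gamma : finType) := PolyregData {
  copy : finType;
  arity : copy -> nat;
  dom_formula : mso Sigma 0 0;
  sel_formula : forall c : copy, mso Sigma (arity c) 0;
  label_formula : forall c : copy, Gamma -> mso Sigma (arity c) 0;
  (* the first [arity c] variables are those of the left-hand atom *)
  order_formula : forall c c' : copy, mso Sigma (arity c + arity c') 0
}.

Section Polyregular.
Variables (Sigma Gamma : finType) (p : polyreg_data Sigma Gamma).

Definition atom (w : seq Sigma) : finType :=
  {c : copy p & (arity c).-tuple (pos w)}.

Definition selected (w : seq Sigma) : {set atom w} :=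
  [set a : atom w | models (sel_formula (tag a)) (tagged a)].

Definition has_label (w : seq Sigma) (a : atom w) (g : Gamma) : bool :=
  models (label_formula (tag a) g) (tagged a).

Definition chi (w : seq Sigma) (a b : atom w) : bool :=
  models (order_formula (tag a) (tag b)) (cat_tuple (tagged a) (tagged b)).

Definition label (w : seq Sigma) (a : atom w) : option Gamma :=
  [pick g | has_label a g].

End Polyregular.

Record polyreg (Sigma Gamma : finType) := Polyreg {
  polyreg_base :> polyreg_data Sigma Gamma;
  copy_nonempty : (0 < #|copy polyreg_base|)%N;
  arity_gt0 : forall c : copy polyreg_base, (0 < arity c)%N;
  label_unique : forall (w : seq Sigma) (a : atom polyreg_base w),
    a \in selected polyreg_base w -> exists! g : Gamma, has_label a g;
  chi_irreflexive : forall w : seq Sigma,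
    {in selected polyreg_base w, irreflexive (@chi _ _ polyreg_base w)};
  chi_transitive : forall w : seq Sigma,
    {in selected polyreg_base w & &, transitive (@chi _ _ polyreg_base w)};
  chi_total : forall w : seq Sigma,
    {in selected polyreg_base w &, forall a b, a != b -> chi a b || chi b a}
}.

Record rank_source (Sigma : finType) (d : nat) := RankSource {
  state : finType;
  init : state;
  delta : state -> Sigma -> state;
  omega : state -> Sigma -> 'rV[int]_d
}.

Definition state_before (Sigma : finType) (d : nat) (A : rank_source Sigma d)
    (w : seq Sigma) (i : nat) : state A :=
  foldl (@delta _ _ A) (init A) (take i w).

Definition prefix_rank (Sigma : finType) (d : nat) (A : rank_source Sigma d)
    (w : seq Sigma) (i : nat) : 'rV[int]_d :=
  \sum_(j : pos w | (j < i)%N) omega (state_before A w j) (letter j).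

Record rank_fun (Sigma : finType) (d k : nat) := RankFun {
  rank_const : 'rV[int]_d;
  source : 'I_k -> rank_source Sigma d;
  table : forall r : 'I_k, state (source r) -> Sigma -> 'rV[int]_d
}.

Definition rank_eval (Sigma : finType) (d k : nat) (f : rank_fun Sigma d k)
    (w : seq Sigma) (x : k.-tuple (pos w)) : 'rV[int]_d :=
  rank_const f +
  \sum_(r < k) (prefix_rank (source f r) w (tnth x r) +
                table (state_before (source f r) w (tnth x r))
                      (letter (tnth x r))).

Definition ltlex (d : nat) (u v : 'rV[int]_d) : bool :=
  (([tuple u 0 i | i < d] : d.-tuplelexi int) <
   ([tuple v 0 i | i < d] : d.-tuplelexi int))%O.

Record wrp_pres (Sigma Gamma : finType) := WrpPres {
  wrp_polyreg :> polyreg Sigma Gamma;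
  wrp_dim : nat;
  wrp_rank : forall c : copy wrp_polyreg, rank_fun Sigma wrp_dim (arity c)
}.

Section Wrp.
Variables (Sigma Gamma : finType) (p : wrp_pres Sigma Gamma).

Definition atom_rank (w : seq Sigma) (a : atom p w) : 'rV[int]_(wrp_dim p) :=
  rank_eval (wrp_rank (tag a)) (tagged a).

Definition prec (w : seq Sigma) (a b : atom p w) : bool :=
  ltlex (atom_rank a) (atom_rank b)
  || (atom_rank a == atom_rank b) && chi a b.

(* [sort] expects a reflexive comparison. *)
Definition preceq (w : seq Sigma) (a b : atom p w) : bool :=
  (a == b) || prec a b.

(* Every selected atom has a label, so [pmap] discards nothing. *)
Definition wrp_map (w : seq Sigma) : option (seq Gamma) :=
  if models (dom_formula p) ([tuple] : 0.-tuple (pos w)) then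
    Some (pmap (@label _ _ p w) (sort (@preceq w) (enum (selected p w))))
  else None.

End Wrp.

Definition WRP (Sigma Gamma : finType)
    (T : seq Sigma -> option (seq Gamma)) : Prop :=
  exists p : wrp_pres Sigma Gamma, T =1 wrp_map p.

(* Main.v *)
Require Import Defs.
From mathcomp Require Import all_boot all_order all_algebra.
From mathcomp Require Import zify ring lra.

(** Feed the paths P = U^(2u) (UD)^u D^(2u), of semilength n = 3u, to a map that
    exchanges area and dinv.  They attain the largest possible value n(n-1)/2 of
    area + dinv, hence so do their images Q.  A path that attains it has the area
    sequence 0, 1, ..., l-1 followed by entries in {l-2, l-1}, where l is the
    length of its initial run of letters U ([top_degree_run]).  As
    area Q = dinv P = u(u-1)/2, this forces 6ul - l^2 - u^2 to be O(u), so that l/u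
    tends to the irrational number 3 - 2 sqrt 2.

    For a presentation of the map, l is the number of selected atoms that precede
    the first atom labelled D ([first_descent]).  Along the values u = N! tau, for
    a fixed large N, this number turns out to be a rational multiple of tau up to
    a bounded error, which is the contradiction ([irrational_slope]).  The reasons
    are as follows.

    Formulas are evaluated by finite automata ([sat_recognizable]).  The words at
    hand are made of cells x^(N!), which act idempotently on every automaton and
    rank source with at most N states.  Copying a cell that carries no marked
    position therefore preserves the truth of formulas ([foldl_thicken]), while it
    shifts the ranks further right by a constant ([rank_at_stretch]).  So, if
    positions are given by fixed displacements from some landmarks, formulas are
    constant and ranks are affine as functions of the distances between the
    landmarks ([segments_stable], [rankN_affine]).

    As the output is as long as the input, there are only linearly many selected
    atoms.  Two clusters of positions far from each other and from the boundaries
    of the three blocks of the word could slide independently, giving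
    quadratically many atoms ([far_from_boundary_close]).  Up to bounded data, an
    atom is thus determined by one parameter i, the place of its only free cluster
    ([selected_shape], [locates_cut_inj]).  Among the atoms labelled D, the first
    one has no free cluster: its rank is affine in i, so either moving the cluster
    by one cell lowers the rank, or the rank is constant and the order formula,
    which treats all long moves alike, prefers some other position
    ([minimal_near_boundary]).  Finally, within each of the finitely many families
    of atoms with parameter i, comparing a rank that is affine in i and tau with
    one that is affine in tau amounts to a single linear inequality, apart from
    boundedly many i ([lex_affine]); counting the solutions gives the rational
    slope ([affine_lex_slope], [prefix_count_slope]). *)


Set Implicit Arguments.
Unset Strict Implicit.
Unset Printing Implicit Defensive.

(** * Finite automata for monadic second-order formulas *)

Section Recognizable.
Variable Sigma : finType.

Definition mso_letter (k m : nat) : Type :=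
  Sigma * k.-tuple bool * m.-tuple bool.

Definition annotate (w : seq Sigma) (k m : nat) (e : k.-tuple (pos w))
    (E : m.-tuple {set pos w}) : seq (mso_letter k m) :=
  [seq (letter i, map_tuple (eq_op^~ i) e,
        map_tuple (fun X : {set pos w} => i \in X) E) | i <- enum (pos w)].

Definition mso_predicate (k m : nat) : Type :=
  forall w : seq Sigma, k.-tuple (pos w) -> m.-tuple {set pos w} -> bool.

Definition recognizable (k m : nat) (S : mso_predicate k m) : Prop :=
  exists (Q : finType) (q0 : Q) (d : Q -> mso_letter k m -> Q) (F : pred Q),
    forall w e E, S w e E = F (foldl d q0 (annotate e E)).

Lemma recognizable_ext k m (S S' : mso_predicate k m) :
  (forall w e E, S w e E = S' w e E) -> recognizable S -> recognizable S'.
Proof.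
by move=> eqS [Q [q0 [d [F H]]]]; exists Q, q0, d, F => w e E; rewrite -eqS.
Qed.

Lemma recognizable_not k m (S : mso_predicate k m) :
  recognizable S -> recognizable (fun w e E => ~~ S w e E).
Proof.
case=> Q [q0 [d [F H]]]; exists Q, q0, d, (fun q => ~~ F q) => w e E.
by rewrite H.
Qed.

Lemma foldl_pair (T Q1 Q2 : Type) (d1 : Q1 -> T -> Q1) (d2 : Q2 -> T -> Q2)
    q1 q2 s :
  foldl (fun (q : Q1 * Q2) x => (d1 q.1 x, d2 q.2 x)) (q1, q2) s =
  (foldl d1 q1 s, foldl d2 q2 s).
Proof. by elim: s q1 q2 => //= x s IH q1 q2; rewrite IH. Qed.

Lemma recognizable_and k m (S1 S2 : mso_predicate k m) :
  recognizable S1 -> recognizable S2 ->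
  recognizable (fun w e E => S1 w e E && S2 w e E).
Proof.
move=> [Q1 [q1 [d1 [F1 H1]]]] [Q2 [q2 [d2 [F2 H2]]]].
exists (Q1 * Q2)%type, (q1, q2), (fun q x => (d1 q.1 x, d2 q.2 x)),
  (fun q => F1 q.1 && F2 q.2) => w e E.
by rewrite foldl_pair H1 H2.
Qed.

(** Quantifying a set over the members of a duplicate-free list amounts to
    guessing one bit per letter, so the powerset construction applies. *)
Lemma foldl_guess (T : finType) (X Y : Type) (Q : finType) (d : Q -> Y -> Q)
    (h : T -> X) (g : X -> bool -> Y) (S : {set Q}) (l : seq T) (q : Q) :
  uniq l ->
  reflect (exists2 q1, q1 \in S &
             exists I : {set T}, q = foldl d q1 [seq g (h i) (i \in I) | i <- l])
    (q \in foldl (fun (A : {set Q}) x =>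
                    [set q' | [exists q1 in A, [exists b, q' == d q1 (g x b)]]])
             S [seq h i | i <- l]).
Proof.
elim: l S => [|i l IH] S /=.
  move=> _; apply: (iffP idP) => [qS|[q1 q1S [_ ->]] //].
  by exists q => //; exists set0.
case/andP=> il ul; apply: (iffP (IH _ ul)).
  case=> q1; rewrite inE => /existsP[q2 /andP[q2S /existsP[b /eqP->]]] [I ->].
  exists q2 => //; exists (if b then i |: I else I :\ i).
  congr (foldl d (d q2 (g (h i) _)) _).
    by case: b; rewrite !inE eqxx.
  apply/eq_in_map => j jl; congr g.
  have ji : j != i by apply: contraNneq il => <-.
  by case: b; rewrite !inE (negPf ji).
case=> q1 q1S [I ->]; exists (d q1 (g (h i) (i \in I))); last by exists I.
rewrite inE; apply/existsP; exists q1; rewrite q1S /=.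
by apply/existsP; exists (i \in I).
Qed.

Lemma map_tuple_cons (A B : Type) (f : A -> B) k (a : A) (t : k.-tuple A) :
  map_tuple f (cons_tuple a t) = cons_tuple (f a) (map_tuple f t).
Proof. exact: val_inj. Qed.

Lemma recognizable_ex_set k m (S : mso_predicate k m.+1) :
  recognizable S ->
  recognizable (fun w e E => [exists I : {set pos w}, S w e (cons_tuple I E)]).
Proof.
case=> Q [q0 [d [F H]]].
pose g (x : mso_letter k m) (b : bool) : mso_letter k m.+1 :=
  (x.1.1, x.1.2, cons_tuple b x.2).
exists {set Q}, [set q0], (fun (A : {set _}) x =>
  [set q' | [exists q1 in A, [exists b, q' == d q1 (g x b)]]]),
  (fun A : {set _} => [exists q in A, F q]) => w e E.
have eqA (I : {set pos w}) : annotate e (cons_tuple I E) =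
    [seq g (letter i, map_tuple (eq_op^~ i) e,
        map_tuple (fun X : {set pos w} => i \in X) E) (i \in I) | i <- enum (pos w)].
  by apply: eq_map => i; rewrite map_tuple_cons.
apply/existsP/existsP => [[I]|[q /andP[/foldl_guess]]].
  rewrite H eqA => FI; eexists; apply/andP; split; last exact: FI.
  by apply/foldl_guess; [exact: enum_uniq|exists q0; [rewrite inE|exists I]].
move=> /(_ (enum_uniq _))[q1]; rewrite inE => /eqP-> [I ->] FI; exists I.
by rewrite H eqA.
Qed.

(** The two bits say whether one mark, respectively two marks, have been read. *)
Definition count2 (c : bool * bool) (b : bool) : bool * bool :=
  (c.1 || b, c.2 || (c.1 && b)).

Lemma foldl_count2 (T : Type) (p : pred T) (s : seq T) :
  foldl (fun c x => count2 c (p x)) (false, false) s =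
  (0 < count p s, 1 < count p s).
Proof.
elim/last_ind: s => //= s x IH; rewrite foldl_rcons IH /count2 /=.
by rewrite -cats1 count_cat /= addn0; case: (p x); case: (count p s) => [|[|n]].
Qed.

(** A position variable is a set variable that is constrained to be a
    singleton, which two bits of memory check. *)
Lemma recognizable_ex_pos k m (S : mso_predicate k.+1 m) :
  recognizable S ->
  recognizable (fun w e E => [exists i : pos w, S w (cons_tuple i e) E]).
Proof.
case=> Q [q0 [d [F H]]].
pose g (x : mso_letter k m) (b : bool) : mso_letter k.+1 m * bool :=
  ((x.1.1, cons_tuple b x.1.2, x.2), b).
pose d' (q : Q * (bool * bool)) (y : mso_letter k.+1 m * bool) :=
  (d q.1 y.1, count2 q.2 y.2).
exists {set Q * (bool * bool)}, [set (q0, (false, false))], (fun (A : {set _}) x =>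
  [set q' | [exists q1 in A, [exists b, q' == d' q1 (g x b)]]]),
  (fun A : {set _} => [exists q in A, [&& F q.1, q.2.1 & ~~ q.2.2]]) => w e E.
pose h (i : pos w) : mso_letter k m := (letter i, map_tuple (eq_op^~ i) e,
        map_tuple (fun X : {set pos w} => i \in X) E).
have run (I : {set pos w}) :
    foldl d' (q0, (false, false)) [seq g (h i) (i \in I) | i <- enum (pos w)] =
    (foldl d q0 [seq (g (h i) (i \in I)).1 | i <- enum (pos w)],
     (0 < #|I|, 1 < #|I|)).
  rewrite /d' (foldl_pair (fun q (y : _ * bool) => d q y.1)
                          (fun c (y : _ * bool) => count2 c y.2)).
  rewrite (_ : #|I| = count (fun i => i \in I) (enum (pos w))); last first.
    by rewrite cardE -size_filter enumT.
  rewrite -foldl_count2; congr pair; first by elim: (enum _) (q0) => //= *.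
  by elim: (enum _) (false, false) => //= *.
have eqA (i0 : pos w) : annotate (cons_tuple i0 e) E =
    [seq (g (h i) (i \in [set i0])).1 | i <- enum (pos w)].
  by apply: eq_map => i; rewrite map_tuple_cons /= inE eq_sym.
apply/existsP/existsP => [[i0]|[q /andP[/foldl_guess]]].
  rewrite H eqA => FI; exists (foldl d' (q0, (false, false))
    [seq g (h i) (i \in [set i0]) | i <- enum (pos w)]).
  rewrite run /= FI cards1 !andbT.
  apply/foldl_guess; first exact: enum_uniq.
  by exists (q0, (false, false)); [rewrite inE|exists [set i0]; rewrite run cards1].
move=> /(_ (enum_uniq _))[q1]; rewrite inE => /eqP-> [I ->].
rewrite run /= => /and3P[FI I0 I1].
have /cards1P[i0 eI] : #|I| == 1 by rewrite eqn_leq I0 leqNgt I1.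
by exists i0; rewrite H eqA -eI.
Qed.

(** Reading a tuple of positions left to right, the first letter that bears
    one of the relevant marks already decides an atomic formula. *)
Lemma recognizable_first k m (S : mso_predicate k m)
    (c v : pred (mso_letter k m)) :
  (forall w e E, exists2 i : pos w,
     forall j, c (letter j, map_tuple (eq_op^~ j) e,
                  map_tuple (fun X : {set pos w} => j \in X) E) -> i <= j &
     c (letter i, map_tuple (eq_op^~ i) e,
                  map_tuple (fun X : {set pos w} => i \in X) E) /\
     S w e E = v (letter i, map_tuple (eq_op^~ i) e,
                  map_tuple (fun X : {set pos w} => i \in X) E)) ->
  recognizable S.
Proof.
move=> H.
pose d (q : option bool) x := if q is Some b then Some b else
  if c x then Some (v x) else None.
exists (option bool), None, d, (eq_op (Some true)) => w e E.
have [i ilt [ci ->]] := H w e E.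
have run (s1 s2 : seq (mso_letter k m)) y : ~~ has c s1 -> c y ->
    foldl d None (s1 ++ y :: s2) = Some (v y).
  rewrite foldl_cat => nc cy; rewrite (_ : foldl d None s1 = None).
    by rewrite /= cy; elim: s2.
  by elim: s1 nc => //= z s1 IH; rewrite negb_or => /andP[/negPf-> /IH].
rewrite /annotate -[enum _](cat_take_drop i) map_cat (drop_nth i); last first.
  by rewrite -cardE card_ord.
rewrite nth_ord_enum run; last first.
- exact: ci.
- rewrite has_map; apply/hasPn => j; apply: contraL => /ilt le_ij.
  apply/negP => /(map_f val); rewrite map_take val_enum_ord take_iota mem_iota.
  by have := ltn_ord i; rewrite /= in le_ij *; lia.
by case: (v _).
Qed.

(** Büchi's theorem.  Disjunctions and universal quantifiers are reduced to the
    other connectives by negation. *)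
Lemma sat_recognizable k m (phi : mso Sigma k m) :
  recognizable (fun w e E => @sat Sigma w k m phi e E).
Proof.
elim: phi => {k m}
  [k m x y|k m x y|k m a x|k m x X|k m f IH|k m f IHf g IHg|k m f IHf g IHg
  |k m f IH|k m f IH|k m f IH|k m f IH] /=.
- apply: (recognizable_first (c := fun l => tnth l.1.2 x || tnth l.1.2 y)
    (v := fun l => ~~ tnth l.1.2 y)) => w e E.
  exists (if tnth e x < tnth e y then tnth e x else tnth e y).
    by move=> j; rewrite !tnth_map => /orP[] /eqP->; case: ltnP => // /ltnW.
  rewrite !tnth_map /=; case: ltnP => h; rewrite !eqxx ?orbT //.
  by split=> //; rewrite -val_eqE /= gtn_eqF.
- apply: (recognizable_first (c := fun l => tnth l.1.2 x || tnth l.1.2 y)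
    (v := fun l => tnth l.1.2 x && tnth l.1.2 y)) => w e E.
  exists (if tnth e x < tnth e y then tnth e x else tnth e y).
    by move=> j; rewrite !tnth_map => /orP[] /eqP->; case: ltnP => // /ltnW.
  by rewrite !tnth_map /=; case: ltnP => h; rewrite !eqxx ?orbT ?andbT // eq_sym.
- apply: (recognizable_first (c := fun l => tnth l.1.2 x)
    (v := fun l => l.1.1 == a)) => w e E.
  exists (tnth e x) => [j|]; first by rewrite !tnth_map => /eqP->.
  by rewrite !tnth_map eqxx.
- apply: (recognizable_first (c := fun l => tnth l.1.2 x)
    (v := fun l => tnth l.2 X)) => w e E.
  exists (tnth e x) => [j|]; first by rewrite !tnth_map => /eqP->.
  by rewrite !tnth_map eqxx.
- exact: recognizable_not.
- exact: recognizable_and.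
- apply: recognizable_ext (recognizable_not (recognizable_and
    (recognizable_not IHf) (recognizable_not IHg))) => w e E.
  by rewrite negb_and !negbK.
- exact: (recognizable_ex_pos IH).
- apply: recognizable_ext (recognizable_not (recognizable_ex_pos
    (recognizable_not IH))) => w e E.
  by rewrite negb_exists; apply: eq_forallb => i; rewrite negbK.
- exact: (recognizable_ex_set IH).
- apply: recognizable_ext (recognizable_not (recognizable_ex_set
    (recognizable_not IH))) => w e E.
  by rewrite negb_exists; apply: eq_forallb => i; rewrite negbK.
Qed.

End Recognizable.

(** ** Words marked with numeric positions *)

Section Marks.
Variable Sigma : finType.

(** Positions are natural numbers here, so that the marks of a factor of a word
    make sense without reference to the whole word. *)
Fixpoint mark (k : nat) (e : k.-tuple nat) (j : nat) (w : seq Sigma) :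
    seq (Sigma * k.-tuple bool) :=
  if w is a :: w' then (a, map_tuple (eq_op^~ j) e) :: mark e j.+1 w' else [::].

Lemma mark_cat k (e : k.-tuple nat) j (w1 w2 : seq Sigma) :
  mark e j (w1 ++ w2) = mark e j w1 ++ mark e (j + size w1) w2.
Proof.
by elim: w1 j => [|a w1 IH] j /=; rewrite ?addn0 // IH addSnnS.
Qed.

Lemma models_automaton k (phi : mso Sigma k 0) :
  exists (Q : finType) (q0 : Q) (d : Q -> Sigma * k.-tuple bool -> Q)
      (F : pred Q), forall (w : seq Sigma) (x : k.-tuple (pos w)),
    models phi x = F (foldl d q0 (mark (map_tuple val x) 0 w)).
Proof.
have [Q [q0 [d [F H]]]] := sat_recognizable phi.
exists Q, q0, (fun q l => d q (l, [tuple])), F => w x.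
rewrite /models H; congr F.
have fold_map (q : Q) s :
    foldl (fun q l => d q (l, [tuple])) q s = foldl d q [seq (l, [tuple]) | l <- s].
  by elim: s q => //=.
rewrite {}fold_map; congr foldl; rewrite /annotate.
have -> : [seq (letter i, map_tuple (eq_op^~ i) x,
    map_tuple (fun X : {set pos w} => i \in X) [tuple]) | i <- enum (pos w)] =
  [seq (l, [tuple]) | l <-
    [seq (letter i, map_tuple (eq_op^~ (val i)) (map_tuple val x)) | i <- enum (pos w)]].
  rewrite -map_comp; apply: eq_map => i /=; congr (_, _, _); last exact: val_inj.
  by apply: eq_from_tnth => r; rewrite !tnth_map -val_eqE.
congr map.
have -> : [seq (letter i, map_tuple (eq_op^~ (val i)) (map_tuple val x)) | i <- enum (pos w)] =
  [seq (p.2, map_tuple (eq_op^~ p.1) (map_tuple val x)) | p <- zip (iota 0 (size w)) w].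
  have <- : zip (map val (enum (pos w))) (map (@letter _ w) (enum (pos w))) =
            zip (iota 0 (size w)) w.
    by rewrite val_enum_ord (map_tnth_enum (in_tuple w)).
  by elim: (enum _) => //= i s ->.
move: (map_tuple _ x) => y; clear.
by elim: w 0 => //= a w' IH j; rewrite IH.
Qed.

End Marks.

(** * Words made of idempotent cells, and their stretchings *)

(** After [N`!] steps the orbit has entered its cycle, whose length divides
    [N`!]. *)
Lemma iter_fact_idem (Q : finType) (g : Q -> Q) (N : nat) (q : Q) :
  #|Q| <= N -> iter N`! g (iter N`! g q) = iter N`! g q.
Proof.
move=> QN.
have [i [j [ij jN eij]]] : exists i j, [/\ i < j, j <= N & iter i g q = iter j g q].
  have : ~~ injectiveb (fun i : 'I_N.+1 => iter i g q).
    apply/injectiveP => /leq_card; rewrite card_ord => h.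
    by have := leq_trans h QN; rewrite ltnn.
  case/injectivePn => i [j neij eqij].
  case: (ltngtP i j) => [lt|lt|/val_inj /eqP]; last by rewrite (negPf neij).
    by exists i, j; split=> //; rewrite -ltnS.
  by exists j, i; split=> //; rewrite -ltnS.
have per n a : i <= a -> iter (a + n * (j - i)) g q = iter a g q.
  elim: n a => [|n IH] a ia; first by rewrite addn0.
  rewrite mulSn addnA IH; last by lia.
  rewrite (_ : a + (j - i) = (a - i) + j); last by lia.
  by rewrite iterD -eij -iterD subnK.
rewrite -iterD; have /dvdnP[n en] : j - i %| N`! by apply: dvdn_fact; lia.
rewrite {2}en per //.
have N0 : 0 < N by lia.
by rewrite (leq_trans _ (_ : N <= N`!)) //; [lia|rewrite dvdn_leq ?fact_gt0 ?dvdn_fact ?N0 /=].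
Qed.

Lemma iter_idem (T : Type) (g : T -> T) n q :
  (forall q, g (g q) = g q) -> iter n.+1 g q = g q.
Proof. by move=> gg; elim: n => //= n ->. Qed.

Definition pattern (b : nat) : seq step :=
  match b with 0 => [:: U; U] | 1 => [:: U; D] | _ => [:: D; D] end.

(** The factorial makes the effect of a cell on any automaton with at most [N]
    states idempotent. *)
Definition cell (N b : nat) : seq step := flatten (nseq N`! (pattern b)).

Definition cells (N : nat) (bs : seq nat) : seq step :=
  flatten [seq cell N b | b <- bs].

Definition cell_len (N : nat) := N`!.*2.

(** Positions of [cells N bs] are handled as pairs of a cell index and an
    offset, because stretching moves cells and keeps offsets. *)
Definition place (N : nat) (p : nat * nat) : nat := p.1 * cell_len N + p.2.

Definition places (N k : nat) (c : k.-tuple (nat * nat)) : k.-tuple nat :=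
  map_tuple (place N) c.

Definition extra (l : seq (nat * nat)) (J : nat) : nat :=
  \sum_(p <- l | p.1 == J) p.2.

Definition extra_before (l : seq (nat * nat)) (J : nat) : nat :=
  \sum_(p <- l | p.1 < J) p.2.

(** A pair [(J, n)] in [l] asks for [n] additional copies of cell [J]. *)
Fixpoint thicken (l : seq (nat * nat)) (J : nat) (bs : seq nat) : seq nat :=
  if bs is b :: bs' then nseq (extra l J).+1 b ++ thicken l J.+1 bs' else [::].

Definition stretch (l : seq (nat * nat)) (p : nat * nat) : nat * nat :=
  (p.1 + extra_before l p.1, p.2).

Definition stretches (k : nat) l (c : k.-tuple (nat * nat)) :=
  map_tuple (stretch l) c.

Lemma cell_len_gt0 N : 0 < cell_len N.
Proof. by rewrite /cell_len double_gt0 fact_gt0. Qed.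

Lemma size_cell N b : size (cell N b) = cell_len N.
Proof.
have sp : size (pattern b) = 2 by case: b => [|[]].
rewrite /cell /cell_len -muln2; elim: N`! => //= n IH.
by rewrite size_cat IH sp; lia.
Qed.

Lemma size_cells N bs : size (cells N bs) = size bs * cell_len N.
Proof. by elim: bs => //= b bs IH; rewrite /cells /= size_cat size_cell IH mulSn. Qed.

Lemma cells_cat N s1 s2 : cells N (s1 ++ s2) = cells N s1 ++ cells N s2.
Proof. by rewrite /cells map_cat flatten_cat. Qed.

Lemma extra_beforeS l J : extra_before l J.+1 = extra_before l J + extra l J.
Proof.
rewrite /extra_before /extra (bigID (fun p => p.1 < J)) /=.
by congr addn; apply: eq_bigl => p; lia.
Qed.

Lemma extra_before0 l : extra_before l 0 = 0.
Proof. by rewrite /extra_before big_pred0. Qed.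

Lemma extra_before_leq l : {homo extra_before l : J J' / J <= J'}.
Proof.
move=> J J'; elim: J' => [|J' IH]; first by rewrite leqn0 => /eqP->.
by rewrite leq_eqVlt => /orP[/eqP->//|/IH]; rewrite extra_beforeS; lia.
Qed.

Definition blank (k : nat) (w : seq step) : seq (step * k.-tuple bool) :=
  [seq (a, [tuple of nseq k false]) | a <- w].

Lemma mark_blank k (e : k.-tuple nat) j (w : seq step) :
  (forall x, x \in e -> ~~ (j <= x < j + size w)) -> mark e j w = blank k w.
Proof.
elim: w j => //= a w IH j h; rewrite IH; last first.
  by move=> x /h; lia.
congr ((a, _) :: _); apply: eq_from_tnth => r; rewrite tnth_map tnth_nseq /=.
by apply/negbTE/eqP => e0; have := h _ (mem_tnth r e); rewrite e0; lia.
Qed.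

Lemma eq_mark k (e e' : k.-tuple nat) j j' (w : seq step) :
  (forall r x, x < size w -> (tnth e r == j + x) = (tnth e' r == j' + x)) ->
  mark e j w = mark e' j' w.
Proof.
elim: w j j' => //= a w IH j j' h; rewrite (IH _ j'.+1); last first.
  by move=> r x xw; rewrite !addSnnS; apply: h; lia.
congr ((a, _) :: _); apply: eq_from_tnth => r; rewrite !tnth_map /=.
by have := h r 0 isT; rewrite !addn0.
Qed.

Lemma foldl_flatten_nseq (Q X : Type) (d : Q -> X -> Q) n s q :
  foldl d q (flatten (nseq n s)) = iter n (fun q => foldl d q s) q.
Proof. by elim: n q => //= n IH q; rewrite foldl_cat IH -iterSr. Qed.

Lemma blank_flatten k n w :
  blank k (flatten (nseq n w)) = flatten (nseq n (blank k w)).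
Proof. by elim: n => //= n <-; rewrite /blank map_cat. Qed.

Lemma foldl_power_idem (Q : finType) (X : Type) (d : Q -> X -> Q) N s q :
  #|Q| <= N ->
  foldl d (foldl d q (flatten (nseq N`! s))) (flatten (nseq N`! s)) =
  foldl d q (flatten (nseq N`! s)).
Proof. by move=> QN; rewrite !foldl_flatten_nseq iter_fact_idem. Qed.

Section Run.
Variables (N k : nat) (Q : finType) (d : Q -> step * k.-tuple bool -> Q).
Hypothesis QN : #|Q| <= N.

Lemma foldl_blank_cell_idem b q :
  foldl d (foldl d q (blank k (cell N b))) (blank k (cell N b)) =
  foldl d q (blank k (cell N b)).
Proof. by rewrite /cell blank_flatten foldl_power_idem. Qed.

(** An unmarked cell acts idempotently on the states, so the run does not notice
    its additional copies; the marked cells are merely moved. *)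
Lemma foldl_thicken l (c : k.-tuple (nat * nat)) J bs q :
  (forall p : nat * nat, p \in c -> p.2 < cell_len N) ->
  (forall p : nat * nat, p \in c -> extra l p.1 = 0) ->
  foldl d q (mark (places N (stretches l c)) ((J + extra_before l J) * cell_len N)
               (cells N (thicken l J bs))) =
  foldl d q (mark (places N c) (J * cell_len N) (cells N bs)).
Proof.
set L := cell_len N => oc gap; have L0 : 0 < L := cell_len_gt0 N.
have div_place p : p.2 < L -> place N p %/ L = p.1.
  by move=> h; rewrite /place divnMDl // divn_small ?addn0.
elim: bs J q => [//|b bs IH] J q.
rewrite (_ : thicken l J (b :: bs) =
  nseq (extra l J).+1 b ++ thicken l J.+1 bs) // cells_cat.
rewrite (_ : cells N (b :: bs) = cell N b ++ cells N bs) // (mark_cat _ _ (cell N b))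
  (mark_cat _ _ (cells N (nseq _ b))) !foldl_cat.
rewrite size_cell size_cells size_nseq -/L.
rewrite [J * L + L]addnC -mulSn -mulnDl.
have -> : J + extra_before l J + (extra l J).+1 = J.+1 + extra_before l J.+1.
  by rewrite extra_beforeS; lia.
rewrite IH; congr foldl; case: (posnP (extra l J)) => [->|extraJ].
  have -> : cells N (nseq 1 b) = cell N b by rewrite /cells /= cats0.
  congr foldl; apply: eq_mark => r x.
  rewrite size_cell -/L => xL; rewrite !tnth_map.
  set p := tnth c r; have pL : p.2 < L by apply/oc/mem_tnth.
  apply/eqP/eqP => /(congr1 (fun y => (y %/ L, y %% L))).
    rewrite /place -/L /= !modnMDl !divnMDl // !modn_small // !divn_small // !addn0.
    case=> eJ ->; congr (_ * _ + _); apply/eqP; case: ltngtP => // lt.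
      by have := extra_before_leq l lt; have := extra_before_leq l (ltnW lt); lia.
    by have := extra_before_leq l lt; have := extra_before_leq l (ltnW lt); lia.
  rewrite /place -/L /= !modnMDl !divnMDl // !modn_small // !divn_small // !addn0.
  by case=> -> ->.
have -> : mark (places N c) (J * L) (cell N b) = blank k (cell N b).
  apply: mark_blank => _ /mapP[p pc ->]; apply/negP; rewrite size_cell -/L => /andP[h1 h2].
  have : p.1 = J; last by move=> ep; have := gap p pc; rewrite ep; lia.
  rewrite -(div_place p) ?oc //; apply/eqP; rewrite eqn_leq leq_divRL // h1 andbT.
  by rewrite -ltnS ltn_divLR // mulSn addnC.
have -> : mark (places N (stretches l c)) ((J + extra_before l J) * L)
    (cells N (nseq (extra l J).+1 b)) = blank k (cells N (nseq (extra l J).+1 b)).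
  apply: mark_blank => _ /mapP[_ /mapP[p pc ->] ->]; apply/negP.
  rewrite size_cells size_nseq -/L -mulnDl => /andP[h1 h2].
  have nJ : p.1 != J by apply: contraTneq extraJ => <-; rewrite gap.
  have := div_place (stretch l p) (oc _ pc) => /= e1.
  have h3 : J + extra_before l J <= p.1 + extra_before l p.1 by rewrite -e1 leq_divRL.
  have h4 : p.1 + extra_before l p.1 < J + extra_before l J + (extra l J).+1.
    by rewrite -e1 ltn_divLR.
  case: (ltngtP p.1 J) nJ => // lt _; first by have := extra_before_leq l (ltnW lt); lia.
  by have := extra_before_leq l lt; rewrite extra_beforeS; lia.
rewrite /cells map_nseq blank_flatten foldl_flatten_nseq.
by rewrite iter_idem // => q'; apply: foldl_blank_cell_idem.
Qed.

End Run.

(** ** Stability of formulas under stretching *)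

Definition in_cells (N k : nat) (bs : seq nat) (c : k.-tuple (nat * nat)) : Prop :=
  forall p : nat * nat, p \in c -> (p.1 < size bs) && (p.2 < cell_len N).

Definition sat_at (w : seq step) (k : nat) (phi : mso step k 0)
    (e : k.-tuple nat) : bool :=
  [exists x : k.-tuple (pos w), (map_tuple val x == e) && models phi x].

Lemma sat_at_val (w : seq step) k (phi : mso step k 0) (x : k.-tuple (pos w)) :
  sat_at w phi (map_tuple val x) = models phi x.
Proof.
apply/existsP/idP => [[y /andP[/eqP/(congr1 val)/= exy]]|]; last by exists x; rewrite eqxx.
by rewrite (_ : y = x) //; apply/val_inj/(inj_map val_inj).
Qed.

Lemma positions_of (w : seq step) k (e : k.-tuple nat) :
  (forall x, x \in e -> x < size w) ->
  exists x : k.-tuple (pos w), map_tuple val x = e.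
Proof.
move=> h; exists [tuple Ordinal (h _ (mem_tnth r e)) | r < k].
by apply: eq_from_tnth => r; rewrite !(tnth_map, tnth_ord_tuple).
Qed.

Lemma size_thicken l J bs :
  J + extra_before l J + size (thicken l J bs) =
  J + size bs + extra_before l (J + size bs).
Proof.
elim: bs J => [|b bs IH] J; first by rewrite !addn0.
rewrite (_ : thicken l J (b :: bs) =
  nseq (extra l J).+1 b ++ thicken l J.+1 bs) // size_cat size_nseq /=.
by rewrite addnS -addSn -IH extra_beforeS; lia.
Qed.

Lemma in_cells_stretch N k l bs (c : k.-tuple (nat * nat)) :
  in_cells N bs c -> in_cells N (thicken l 0 bs) (stretches l c).
Proof.
move=> h _ /mapP[p /h /andP[h1 h2] ->] /=; rewrite h2 andbT.
have := size_thicken l 0 bs; rewrite !add0n extra_before0 add0n => ->.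
by rewrite -addSn leq_add // extra_before_leq // ltnW.
Qed.

Lemma place_lt N k bs (c : k.-tuple (nat * nat)) :
  in_cells N bs c -> forall x, x \in places N c -> x < size (cells N bs).
Proof.
move=> h _ /mapP[p /h /andP[h1 h2] ->]; rewrite size_cells /place.
apply: leq_trans (_ : p.1.+1 * cell_len N <= _); last by rewrite leq_mul2r h1 orbT.
by rewrite mulSn addnC ltn_add2r.
Qed.

(** The second hypothesis says that only unmarked cells are copied. *)
Definition stretch_stable (N k : nat) (G : seq nat -> k.-tuple (nat * nat) -> bool) :=
  forall bs l c, in_cells N bs c -> (forall p : nat * nat, p \in c -> extra l p.1 = 0) ->
    G (thicken l 0 bs) (stretches l c) = G bs c.

Lemma sat_at_stretch_stable k (phi : mso step k 0) :
  exists N0, forall N, N0 <= N ->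
    stretch_stable N (fun bs c => sat_at (cells N bs) phi (places N c)).
Proof.
have [Q [q0 [d [F H]]]] := models_automaton phi.
exists #|Q| => N QN bs l c inc gap.
have [x ex] := positions_of (place_lt inc).
have [y ey] := positions_of (place_lt (in_cells_stretch (l := l) inc)).
rewrite -ex -ey !sat_at_val !H ex ey.
have := @foldl_thicken N k Q d QN l c 0 bs q0.
rewrite extra_before0 !mul0n => -> //.
by move=> p /inc /andP[].
Qed.

(** ** Ranks under stretching *)

Lemma thicken_cat l J s1 s2 :
  thicken l J (s1 ++ s2) = thicken l J s1 ++ thicken l (J + size s1) s2.
Proof.
elim: s1 J => [|b s1 IH] J; first by rewrite addn0.
rewrite [(b :: s1) ++ s2]/= (_ : forall s, thicken l J (b :: s) =
  nseq (extra l J).+1 b ++ thicken l J.+1 s) // IH catA /=.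
by rewrite addSnnS.
Qed.

Section Ranks.
Import GRing.Theory.
Local Open Scope ring_scope.
Variables (d : nat) (A : rank_source step d).

Fixpoint weight (q : state A) (w : seq step) : 'rV[int]_d :=
  if w is a :: w' then omega q a + weight (delta q a) w' else 0.

Definition run_from (q : state A) (w : seq step) : state A :=
  foldl (@delta _ _ A) q w.

Lemma weight_cat q w1 w2 :
  weight q (w1 ++ w2) = weight q w1 + weight (run_from q w1) w2.
Proof. by elim: w1 q => [|a w1 IH] q /=; rewrite ?add0r // IH addrA. Qed.

Lemma prefix_rank_weight (w : seq step) i : (i <= size w)%N ->
  prefix_rank A w i = weight (init A) (take i w).
Proof.
move=> iw; pose F j := omega (state_before A w j) (nth U w j).
have -> : prefix_rank A w i = \sum_(j < i) F j.
  rewrite /prefix_rank (big_ord_widen _ F iw).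
  by apply: eq_bigr => j _; rewrite /F /letter (tnth_nth U).
elim: i iw => [|i IH] iw; first by rewrite big_ord0 take0.
rewrite big_ord_recr /= IH 1?ltnW // (take_nth U) // -cats1 weight_cat /=.
by rewrite addr0.
Qed.

Variable N : nat.
Hypothesis AN : (#|state A| <= N)%N.

Lemma run_from_cell_idem b q :
  run_from (run_from q (cell N b)) (cell N b) = run_from q (cell N b).
Proof. exact: foldl_power_idem. Qed.

Lemma run_from_cat q w1 w2 : run_from q (w1 ++ w2) = run_from (run_from q w1) w2.
Proof. exact: foldl_cat. Qed.

Lemma run_from_copies b n q :
  run_from q (cells N (nseq n.+1 b)) = run_from q (cell N b).
Proof.
rewrite /cells map_nseq /run_from foldl_flatten_nseq iter_idem //.
exact: run_from_cell_idem.
Qed.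

Lemma run_from_thicken l J bs q :
  run_from q (cells N (thicken l J bs)) = run_from q (cells N bs).
Proof.
elim: bs J q => [//|b bs IH] J q.
rewrite (_ : thicken l J (b :: bs) =
  nseq (extra l J).+1 b ++ thicken l J.+1 bs) // cells_cat.
by rewrite run_from_cat IH run_from_copies -run_from_cat.
Qed.

(** Every copy after the first is read from the state that the cell leads to,
    hence all these copies have the same weight. *)
Definition copy_weight (q : state A) (bs : seq nat) (j : nat) : 'rV[int]_d :=
  weight (run_from q (cells N (take j.+1 bs))) (cell N (nth 0 bs j)).

Lemma weight_copies b n q :
  weight q (cells N (nseq n.+1 b)) =
  weight q (cell N b) + weight (run_from q (cell N b)) (cell N b) *+ n.
Proof.
elim: n => [|n IH]; first by rewrite /cells /= cats0 addr0.
have -> : nseq n.+2 b = nseq n.+1 b ++ [:: b] by rewrite -(nseqD n.+1 1) addn1.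
rewrite cells_cat weight_cat IH run_from_copies.
by rewrite [cells N [:: b]]/cells /= cats0 mulrSr addrA.
Qed.

Lemma weight_thicken l J bs q :
  weight q (cells N (thicken l J bs)) =
  weight q (cells N bs) +
  \sum_(j < size bs) copy_weight q bs j *+ extra l (J + j).
Proof.
elim: bs J q => [|b bs IH] J q; first by rewrite big_ord0 addr0.
rewrite (_ : thicken l J (b :: bs) =
  nseq (extra l J).+1 b ++ thicken l J.+1 bs) // cells_cat weight_cat IH.
rewrite weight_copies run_from_copies (_ : cells N (b :: bs) = cell N b ++ cells N bs) //.
have c1 : cells N [:: b] = cell N b by rewrite /cells /= cats0.
rewrite weight_cat big_ord_recl /= addn0 /copy_weight /= take0 c1.
rewrite -!addrA; congr (_ + _); rewrite addrCA; congr (_ + (_ + _)).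
by apply: eq_bigr => j _; rewrite [cells N (b :: _)]/cells /= run_from_cat addSnnS.
Qed.

Definition rank_at (tab : state A -> step -> 'rV[int]_d) (w : seq step) (x : nat) :=
  prefix_rank A w x + tab (state_before A w x) (nth U w x).

Lemma rank_at_cell tab s b s' x : (x < cell_len N)%N ->
  rank_at tab (s ++ cell N b ++ s') (size s + x) =
  let q := run_from (init A) s in
  weight (init A) s + weight q (take x (cell N b)) +
    tab (run_from q (take x (cell N b))) (nth U (cell N b) x).
Proof.
move=> xL; rewrite /rank_at prefix_rank_weight; last first.
  by rewrite !size_cat leq_add2l size_cell; lia.
have -> : take (size s + x) (s ++ cell N b ++ s') = s ++ take x (cell N b).
  by rewrite take_cat ltnNge leq_addr /= addKn takel_cat // size_cell ltnW.
rewrite /state_before.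
have -> : take (size s + x) (s ++ cell N b ++ s') = s ++ take x (cell N b).
  by rewrite take_cat ltnNge leq_addr /= addKn takel_cat // size_cell ltnW.
rewrite weight_cat nth_cat ltnNge leq_addr /= addKn nth_cat size_cell xL.
by rewrite -/(run_from _ _) run_from_cat.
Qed.

(** Each inserted copy to the left of a position shifts its rank by the constant
    attached to the copied cell, and the state there does not change. *)
Lemma rank_at_stretch tab bs : exists kappa : nat -> 'rV[int]_d,
  forall l p, (p.1 < size bs)%N -> (p.2 < cell_len N)%N ->
  rank_at tab (cells N (thicken l 0 bs)) (place N (stretch l p)) =
  rank_at tab (cells N bs) (place N p) +
  \sum_(p' <- l | (p'.1 < p.1)%N) kappa p'.1 *+ p'.2.
Proof.
exists (copy_weight (init A) bs) => l [J x] /= Jbs xL.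
have ebs : bs = take J bs ++ nth 0 bs J :: drop J.+1 bs.
  by rewrite -drop_nth // cat_take_drop.
have szt : size (take J bs) = J by rewrite size_takel // ltnW.
have -> : cells N bs = cells N (take J bs) ++ cell N (nth 0 bs J) ++ cells N (drop J.+1 bs).
  by rewrite {1}ebs cells_cat.
have -> : cells N (thicken l 0 bs) = cells N (thicken l 0 (take J bs)) ++
    cell N (nth 0 bs J) ++ cells N (nseq (extra l J) (nth 0 bs J) ++
                                    thicken l J.+1 (drop J.+1 bs)).
  rewrite {1}ebs thicken_cat add0n szt cells_cat; congr (_ ++ _).
have -> : place N (J, x) = (size (cells N (take J bs)) + x)%N.
  by rewrite size_cells szt.
have -> : place N (stretch l (J, x)) = (size (cells N (thicken l 0 (take J bs))) + x)%N.
  rewrite size_cells; have := size_thicken l 0 (take J bs).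
  by rewrite !add0n extra_before0 add0n szt => ->.
rewrite !rank_at_cell // run_from_thicken weight_thicken /= szt.
rewrite -!addrA; congr (_ + _); rewrite addrC -!addrA; congr (_ + (_ + _)).
transitivity (\sum_(j < J) \sum_(p <- l | p.1 == j) copy_weight (init A) bs p.1 *+ p.2).
  apply: eq_bigr => j _; rewrite add0n /extra -sumrMnr.
  apply: eq_bigr => p /eqP->; congr (_ *+ _).
  by rewrite /copy_weight take_takel // nth_take.
rewrite (exchange_big_dep (fun p : nat * nat => (p.1 < J)%N)) /=; last first.
  by move=> j p _ /eqP->.
apply: eq_bigr => p pJ; rewrite (big_pred1 (Ordinal pJ)) // => j.
Qed.
End Ranks.

(** * Words made of segments, and tuples attached to their landmarks *)

Definition segments (m : nat) (t n : nat -> nat) : seq nat :=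
  flatten [seq nseq (n j) (t j) | j <- iota 0 m].

Definition landmark (n : nat -> nat) (l : nat) : nat := \sum_(j < l) n j.

(** [(l, c, x)] is offset [x] in the cell that lies [c - K] cells to the right of
    landmark [l]; the bias [K] encodes displacements of both signs. *)
Definition descriptor : Type := nat * nat * nat.

Definition locate (K : nat) (n : nat -> nat) (p : descriptor) : nat * nat :=
  (landmark n p.1.1 + p.1.2 - K, p.2).

Definition locates (K k : nat) (n : nat -> nat) (c : k.-tuple descriptor) :=
  map_tuple (locate K n) c.

Definition valid_descriptor (N K m : nat) (p : descriptor) : bool :=
  [&& p.1.1 <= m, p.1.2 < K.*2, p.2 < cell_len N,
      (p.1.1 == 0) ==> (K <= p.1.2) & (p.1.1 == m) ==> (p.1.2 < K)].

Lemma landmarkS n l : landmark n l.+1 = landmark n l + n l.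
Proof. by rewrite /landmark big_ord_recr. Qed.

Lemma landmark0 n : landmark n 0 = 0.
Proof. by rewrite /landmark big_ord0. Qed.

Lemma landmark_leq n : {homo landmark n : l l' / l <= l'}.
Proof.
move=> l l'; elim: l' => [|l' IH]; first by rewrite leqn0 => /eqP->.
by rewrite leq_eqVlt => /orP[/eqP->//|/IH]; rewrite landmarkS; lia.
Qed.

Lemma segmentsS m t n : segments m.+1 t n = segments m t n ++ nseq (n m) (t m).
Proof. by rewrite /segments -addn1 iotaD map_cat flatten_cat /= cats0. Qed.

Lemma size_segments m t n : size (segments m t n) = landmark n m.
Proof.
elim: m => [|m IH]; first by rewrite /segments landmark0.
by rewrite segmentsS size_cat size_nseq landmarkS IH.
Qed.

Lemma thicken_nseq l J a b :
  thicken l J (nseq a b) = nseq (a + extra_before l (J + a) - extra_before l J) b.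
Proof.
elim: a J => [|a IH] J; first by rewrite addn0 add0n subnn.
rewrite (_ : thicken l J (nseq a.+1 b) =
  nseq (extra l J).+1 b ++ thicken l J.+1 (nseq a b)) // IH -nseqD addSnnS.
congr nseq; have := extra_before_leq l (leq_addr a.+1 J).
by have := extra_before_leq l (leq_addr a J.+1); rewrite addSnnS extra_beforeS; lia.
Qed.

Section Base.
Variables (K m : nat) (n : nat -> nat).
Hypothesis n_large : forall j, j < m -> K.*2 < n j.

(** All lengths [n] arise from the constant length [2K + 1] by adding copies of
    the cell in the middle of each segment, which no descriptor can reach. *)
Definition base_len : nat -> nat := fun _ => K.*2.+1.

Definition growth : seq (nat * nat) :=
  [seq (j * K.*2.+1 + K, n j - K.*2.+1) | j <- iota 0 m].

Lemma landmark_base l : landmark base_len l = l * K.*2.+1.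
Proof. by rewrite /landmark sum_nat_const card_ord. Qed.

(** Near landmark [l], the cells copied to the left are those of the first [l]
    segments. *)
Lemma growth_before (R : Type) (idx : R) (op : R -> R -> R) l
    (F : nat * nat -> R) J : l <= m ->
  l * K.*2.+1 <= J + K -> J <= l * K.*2.+1 + K ->
  \big[op/idx]_(p <- growth | p.1 < J) F p =
  \big[op/idx]_(j < l) F (j * K.*2.+1 + K, n j - K.*2.+1).
Proof.
move=> lm h1 h2; rewrite /growth big_map /=.
rewrite (_ : iota 0 m = index_iota 0 m); last by rewrite /index_iota subn0.
rewrite -(big_mkord xpredT (fun j => F (j * K.*2.+1 + K, n j - K.*2.+1))).
rewrite (big_nat_widen 0 l m) //; apply: eq_bigl => j /=.
by apply/idP/idP; nia.
Qed.

Lemma landmark_growth l : l <= m ->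
  landmark n l = l * K.*2.+1 + \sum_(j < l) (n j - K.*2.+1).
Proof.
elim: l => [|l IH] lm; first by rewrite landmark0 big_ord0.
rewrite landmarkS big_ord_recr /= IH; last exact: ltnW.
rewrite mulSn; have := n_large lm; move: (l * _) (\sum_(j < l) _) => a b; lia.
Qed.

Lemma extra_before_growth l J : l <= m ->
  l * K.*2.+1 <= J + K -> J <= l * K.*2.+1 + K ->
  l * K.*2.+1 + extra_before growth J = landmark n l.
Proof.
by move=> lm h1 h2; rewrite /extra_before (growth_before _ _ snd lm) // landmark_growth.
Qed.

Lemma thicken_segments t :
  thicken growth 0 (segments m t base_len) = segments m t n.
Proof.
suff H m' : m' <= m -> thicken growth 0 (segments m' t base_len) = segments m' t n.
  exact: H.
elim: m' => [//|m' IH] lm.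
rewrite !segmentsS thicken_cat IH 1?ltnW // thicken_nseq size_segments.
rewrite landmark_base add0n; congr (_ ++ nseq _ _).
have := @extra_before_growth m' (m' * K.*2.+1) (ltnW lm) (leq_addr _ _) (leq_addr _ _).
have := @extra_before_growth m'.+1 (m'.+1 * K.*2.+1) lm (leq_addr _ _) (leq_addr _ _).
by rewrite landmarkS mulSn addnC /base_len [K.*2.+1 + _]addnC; lia.
Qed.

Section Descriptors.
Variable N : nat.

Lemma stretch_locate p : valid_descriptor N K m p ->
  stretch growth (locate K base_len p) = locate K n p.
Proof.
case: p => [[l c] x] /and5P[/= lm cK _ /implyP l0 _]; rewrite /stretch /locate /=.
congr pair; rewrite landmark_base.
have h : K <= l * K.*2.+1 + c by case: l l0 {lm} => [|l] l0; [have := l0 isT|]; lia.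
have := @extra_before_growth l (l * K.*2.+1 + c - K) lm; lia.
Qed.

Lemma extra_growth p : valid_descriptor N K m p ->
  extra growth (locate K base_len p).1 = 0.
Proof.
case: p => [[l c] x] /and5P[/= lm cK _ /implyP l0 _]; rewrite landmark_base.
have h : K <= l * K.*2.+1 + c by case: l l0 {lm} => [|l] l0; [have := l0 isT|]; lia.
rewrite /extra /growth big_map big1 // => j /= /eqP e.
exfalso; case: (ltngtP j l) => jl.
- have := leq_mul2r K.*2.+1 j.+1 l; rewrite jl orbT mulSn; lia.
- have := leq_mul2r K.*2.+1 l.+1 j; rewrite jl orbT mulSn; lia.
- by move: e; rewrite jl; lia.
Qed.

Lemma locate_in_cells k t (c : k.-tuple descriptor) :
  (forall p, p \in c -> valid_descriptor N K m p) ->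
  in_cells N (segments m t n) (locates K n c).
Proof.
move=> h _ /mapP[[[l r] x] /h /and5P[/= lm rK xL /implyP l0 /implyP lM] ->].
rewrite xL andbT size_segments /locate /=.
case: (ltngtP l m) lm => // [lm|lm] _; last first.
  subst l; case: (posnP m) => m0; first by have := l0 _; have := lM _; rewrite m0 eqxx /=; lia.
  have := lM (eqxx _); have := landmark_leq n (_ : 1 <= m); rewrite landmarkS landmark0.
  by have := n_large m0; lia.
have := landmark_leq n lm; have := n_large lm; rewrite landmarkS.
by case: (l) l0 => [/(_ isT)|l' _]; lia.
Qed.

End Descriptors.
End Base.

Lemma locates_base_stretch N K m n k (c : k.-tuple descriptor) :
  (forall j, j < m -> K.*2 < n j) ->
  (forall p, p \in c -> valid_descriptor N K m p) ->
  stretches (growth K m n) (locates K (base_len K) c) = locates K n c.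
Proof.
move=> hn hc; apply: val_inj; rewrite /= -map_comp; apply/eq_in_map => p /hc.
exact: stretch_locate.
Qed.

Lemma segments_stable N K m t n n' k (c : k.-tuple descriptor)
    (G : seq nat -> k.-tuple (nat * nat) -> bool) :
  stretch_stable N G ->
  (forall j, j < m -> K.*2 < n j) -> (forall j, j < m -> K.*2 < n' j) ->
  (forall p, p \in c -> valid_descriptor N K m p) ->
  G (segments m t n) (locates K n c) = G (segments m t n') (locates K n' c).
Proof.
move=> stG hn hn' hc.
suff H n1 : (forall j, j < m -> K.*2 < n1 j) ->
    G (segments m t n1) (locates K n1 c) =
    G (segments m t (base_len K)) (locates K (base_len K) c).
  by rewrite !H.
move=> hn1; rewrite -(locates_base_stretch hn1 hc) -(thicken_segments hn1 t).
apply: stG; first by apply: locate_in_cells hc => j; rewrite /base_len.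
by move=> _ /mapP[p /hc hp ->]; apply: extra_growth hp.
Qed.

Section SegmentRanks.
Import GRing.Theory.
Local Open Scope ring_scope.

(** Lengthening a segment inserts copies of one fixed cell, and each copy adds the
    same weight to all the ranks further right. *)
Lemma rank_at_segments d (A : rank_source step d)
    (tab : state A -> step -> 'rV[int]_d) N K m t p :
  (#|state A| <= N)%N -> valid_descriptor N K m p ->
  exists (r0 : 'rV[int]_d) (r : nat -> 'rV[int]_d), forall n,
    (forall j, (j < m)%N -> (K.*2 < n j)%N) ->
    rank_at tab (cells N (segments m t n)) (place N (locate K n p)) =
    r0 + \sum_(j < m) r j *+ n j.
Proof.
move=> AN hp; have [kappa hk] := rank_at_stretch AN tab (segments m t (base_len K)).
case: p hp => [[l c] x] hp; have /and5P[/= lm cK xL /implyP l0 _] := hp.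
pose r j := if (j < l)%N then kappa (j * K.*2.+1 + K)%N else 0.
exists (rank_at tab (cells N (segments m t (base_len K)))
    (place N (locate K (base_len K) (l, c, x))) - \sum_(j < m) r j *+ K.*2.+1), r => n hn.
rewrite -(stretch_locate hn hp) -(thicken_segments hn t).
have inb : in_cells N (segments m t (base_len K))
    (locates K (base_len K) [tuple (l, c, x)]).
  apply: locate_in_cells => [j|p]; first by rewrite /base_len.
  by rewrite inE => /eqP->.
have /andP[lt1 lt2] := inb _ (mem_head _ _).
rewrite hk //; move: (rank_at _ _ _) => a; rewrite -addrA; congr (_ + _).
rewrite [RHS]addrC -sumrB.
have h : (K <= l * K.*2.+1 + c)%N.
  by case: (l) l0 => [|l'] l0'; [have := l0' isT|]; lia.
have -> : \sum_(p' <- growth K m n | (p'.1 < (locate K (base_len K) (l, c, x)).1)%N)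
    kappa p'.1 *+ p'.2 = \sum_(j < l) kappa (j * K.*2.+1 + K)%N *+ (n j - K.*2.+1).
  rewrite (@growth_before K m n _ _ _ l (fun q => kappa q.1 *+ q.2)) //=.
  - by rewrite landmark_base; lia.
  - by rewrite landmark_base; lia.
rewrite (big_ord_widen m (fun j => kappa (j * K.*2.+1 + K)%N *+ (n j - K.*2.+1)) lm).
rewrite big_mkcond /=; apply: eq_bigr => j _; rewrite /r; case: ifP => _; last by rewrite !mul0rn subrr.
by rewrite mulrnBr // hn.
Qed.

End SegmentRanks.

(** * Linear growth leaves each atom at most one free cluster *)

Definition blocks (tau : nat) : seq nat := segments 3 id (fun _ => tau).

Lemma landmark_const tau l : landmark (fun _ => tau) l = l * tau.
Proof. by rewrite /landmark sum_nat_const card_ord. Qed.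

Lemma size_blocks tau : size (blocks tau) = 3 * tau.
Proof. by rewrite size_segments landmark_const. Qed.

Definition near_boundary (K tau J : nat) : Prop :=
  exists2 b, b <= 3 & (b * tau <= J + K) && (J < b * tau + K).

(** At most [k - 1] marked cells remain for the interval that avoids [p]. *)
Lemma empty_cell k (c : k.-tuple (nat * nat)) (p : nat * nat) (x n : nat) :
  p \in c -> k <= n -> ~~ (x <= p.1 < x + n) ->
  exists2 J, x <= J < x + n & forall q : nat * nat, q \in c -> q.1 != J.
Proof.
move=> pc kn px.
have : ~~ all (mem [seq q.1 | q <- c]) (iota x n).
  apply/negP => /allP h; have : size (p.1 :: iota x n) <= size [seq q.1 | q <- c].
    apply: uniq_leq_size; first by rewrite /= mem_iota px iota_uniq.
    move=> J; rewrite inE => /orP[/eqP->|/h] //; exact: map_f.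
  by rewrite /= size_iota size_map size_tuple; lia.
case/allPn => J; rewrite mem_iota => Jx nJ; exists J => // q qc.
by apply: contraNneq nJ => <-; apply: map_f.
Qed.

Lemma extra_before_cons l (x : nat * nat) J :
  extra_before (x :: l) J = (x.1 < J) * x.2 + extra_before l J.
Proof. by rewrite /extra_before big_cons; case: (x.1 < J); rewrite ?mul1n. Qed.

Lemma extra_before_nil J : extra_before [::] J = 0.
Proof. by rewrite /extra_before big_nil. Qed.

Lemma extra0 l J : all (fun x => x.1 != J) l -> extra l J = 0.
Proof.
move=> h; rewrite /extra big_seq_cond big1 // => x /andP[/(allP h)/negPf->//].
Qed.

Lemma thicken_blocks l tau n :
  (forall b, b <= 3 -> extra_before l (b * tau) = b * n) ->
  thicken l 0 (blocks tau) = blocks (tau + n).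
Proof.
move=> h; suff H m : m <= 3 -> thicken l 0 (segments m id (fun _ => tau)) =
    segments m id (fun _ => tau + n) by exact: H.
elim: m => [//|m IH] lm; rewrite !segmentsS thicken_cat IH 1?ltnW //.
rewrite thicken_nseq size_segments landmark_const add0n; congr (_ ++ nseq _ _).
rewrite [m * tau + tau]addnC -mulSn !h ?(ltnW lm) // mulSn; lia.
Qed.

Section OneCluster.
Variables (N k a : nat) (G : seq nat -> k.-tuple (nat * nat) -> bool).
Hypothesis stG : stretch_stable N G.
Hypothesis linear_growth : forall tau (s : seq (k.-tuple (nat * nat))), uniq s ->
  (forall c, c \in s -> in_cells N (blocks tau) c /\ G (blocks tau) c) ->
  size s <= a * tau.

(** Otherwise the clusters of [p] and of [q] could slide independently: moving
    unmarked cells from one side of a cluster to the other, in a longer word,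
    would produce quadratically many tuples. *)
Lemma far_from_boundary_close tau (c : k.-tuple (nat * nat)) (p q : nat * nat) :
  in_cells N (blocks tau) c -> G (blocks tau) c -> p \in c -> q \in c ->
  ~ near_boundary k tau p.1 -> ~ near_boundary k tau q.1 ->
  p.1 <= q.1 -> q.1 <= p.1 + k.
Proof.
move=> inc Gc pc qc np nq pq; case: leqP => // far; exfalso.
have bound (x : nat * nat) : x \in c -> ~ near_boundary k tau x.1 ->
    exists2 b, b < 3 & (b * tau + k <= x.1) && (x.1 + k < b.+1 * tau).
  move=> xc nx; have /andP[xlt _] := inc _ xc; rewrite size_blocks in xlt.
  have tau0 : 0 < tau by case: (tau) xlt; lia.
  have b3 : x.1 %/ tau < 3 by rewrite ltn_divLR.
  have l1 : x.1 %/ tau * tau <= x.1 by apply: leq_divM.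
  have l2 : x.1 < (x.1 %/ tau).+1 * tau by rewrite ltn_ceil.
  exists (x.1 %/ tau) => //; apply/andP; split.
    rewrite leqNgt; apply/negP => lt; apply: nx; exists (x.1 %/ tau); first exact: ltnW.
    by rewrite lt andbT (leq_trans l1) ?leq_addr.
  rewrite ltnNge; apply/negP => lt; apply: nx; exists (x.1 %/ tau).+1 => //.
  by rewrite lt (leq_trans l2) ?leq_addr.
have [bp bp3 /andP[p1 p2]] := bound p pc np.
have [bq bq3 /andP[q1 q2]] := bound q qc nq.
(* Empty cells [J1], [J2] on both sides of [p], and [J3], [J4] on both sides of
   [q]; when [p] and [q] lie in the same block, [J2] and [J3] coincide. *)
have [J1 hJ1 eJ1] : exists2 J, bp * tau <= J < p.1 & forall x : nat * nat, x \in c -> x.1 != J.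
  have [||J hJ eJ] := @empty_cell k c p (bp * tau) (p.1 - bp * tau) pc.
  - by lia.
  - by lia.
  - by exists J => //; lia.
have [J4 hJ4 eJ4] : exists2 J, q.1 < J < bq.+1 * tau &
    forall x : nat * nat, x \in c -> x.1 != J.
  have [||J hJ eJ] := @empty_cell k c q q.1.+1 (bq.+1 * tau - q.1.+1) qc.
  - by lia.
  - by lia.
  - by exists J => //; lia.
have bpq : bp <= bq.
  by rewrite -ltnS -(@ltn_pmul2r tau); [lia|case: (tau) p2 => //; rewrite muln0].
have [J2 [J3 [hJ2 hJ3 J23 eJ2 eJ3]]] : exists J2 J3,
    [/\ p.1 < J2 < bp.+1 * tau, bq * tau <= J3 < q.1, J2 <= J3,
        forall x : nat * nat, x \in c -> x.1 != J2 &
        forall x : nat * nat, x \in c -> x.1 != J3].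
  case: (ltngtP bp bq) bpq => // [lt|ebpq] _.
    have [||J hJ eJ] := @empty_cell k c p p.1.+1 (bp.+1 * tau - p.1.+1) pc.
    - by lia.
    - by lia.
    have [||J' hJ' eJ'] := @empty_cell k c q (bq * tau) (q.1 - bq * tau) qc.
    - by lia.
    - by lia.
    exists J, J'; have := leq_mul2r tau bp.+1 bq; rewrite lt orbT => h.
    by split=> //; lia.
  have [||J hJ eJ] := @empty_cell k c p p.1.+1 (q.1 - p.1.+1) pc.
  - by lia.
  - by lia.
  by exists J, J; rewrite -ebpq in q1 q2 *; split=> //; lia.
have /fin_all_exists[z hz] (b : 'I_3) : exists J, (b * tau <= J < b.+1 * tau) /\
    forall x : nat * nat, x \in c -> x.1 != J.
  case: (eqVneq (b : nat) bp) => [->|nb].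
    by exists J1; split=> //; move: hJ1 p2; rewrite mulSn; lia.
  have [||J hJ eJ] := @empty_cell k c p (b * tau) tau pc.
  - by move: p1 p2; rewrite mulSn; lia.
  - case: (ltngtP b bp) nb => // h _.
      by have := leq_mul2r tau b.+1 bp; rewrite h orbT mulSn; lia.
    by have := leq_mul2r tau bp.+1 b; rewrite h orbT; lia.
  by exists J; split=> //; rewrite mulSn; lia.
(* [M] is chosen so that [M * M] exceeds [a * (tau + 2 * M)]. *)
pose M := a * (tau + 2) + 1.
(* The cells [z] receive what is missing for each block to grow by [2 * M]. *)
pose fill b := 2 * M - (b == bp) * M - (b == bq) * M.
pose i0 : 'I_3 := inord 0; pose i1 : 'I_3 := inord 1; pose i2 : 'I_3 := inord 2.
pose l (i j : nat) := [:: (J1, i); (J2, M - i); (J3, j); (J4, M - j);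
  (z i0, fill 0); (z i1, fill 1); (z i2, fill 2)].
have [hz0 ez0] := hz i0; have [hz1 ez1] := hz i1; have [hz2 ez2] := hz i2.
have e0 : nat_of_ord i0 = 0 by rewrite /i0 inordK.
have e1 : nat_of_ord i1 = 1 by rewrite /i1 inordK.
have e2 : nat_of_ord i2 = 2 by rewrite /i2 inordK.
rewrite e0 in hz0; rewrite e1 in hz1; rewrite e2 in hz2.
pose E x := (z i0 < x) * fill 0 + (z i1 < x) * fill 1 + (z i2 < x) * fill 2.
have eb i j J : extra_before (l i j) J = (J1 < J) * i + (J2 < J) * (M - i) +
    (J3 < J) * j + (J4 < J) * (M - j) + E J.
  by rewrite /l !extra_before_cons extra_before_nil /E /=; lia.
have thick i j : i < M -> j < M -> thicken (l i j) 0 (blocks tau) = blocks (tau + 2 * M).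
  move=> iM jM; apply: thicken_blocks => b b3; rewrite eb /E /fill.
  clear -iM jM b3 bp3 bq3 hJ1 hJ2 hJ3 hJ4 hz0 hz1 hz2 p2 q2.
  move: M iM jM => M iM jM; move: (z i0) (z i1) (z i2) hz0 hz1 hz2 => z0 z1 z2 hz0 hz1 hz2.
  have lt3 x : x < 3 -> [\/ x = 0, x = 1 | x = 2].
    by case: x => [|[|[|]]] // _; [constructor 1|constructor 2|constructor 3].
  have lt4 : [\/ b = 0, b = 1, b = 2 | b = 3].
    by case: b b3 => [|[|[|[|]]]] // _; [constructor 1|constructor 2|constructor 3|constructor 4].
  move: hJ1 hJ2 hJ3 hJ4 hz0 hz1 hz2 p2 q2 iM jM.
  case: (lt3 _ bp3) => ->; case: (lt3 _ bq3) => ->; case: lt4 => -> /=;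
    rewrite ?mul0n ?mul1n ?ltn0 => hJ1 hJ2 hJ3 hJ4 hz0 hz1 hz2 p2 q2 iM jM;
    (repeat match goal with |- context [nat_of_bool (?x < ?y)] =>
       first [rewrite (_ : (x < y) = true); [|by lia]
             |rewrite (_ : (x < y) = false); [|by lia]] end);
    by rewrite ?mul0n ?mul1n; lia.
have gap i j (x : nat * nat) : x \in c -> extra (l i j) x.1 = 0.
  move=> xc; apply: extra0; rewrite /= ![_ == x.1]eq_sym.
  by rewrite eJ1 // eJ2 // eJ3 // eJ4 // ez0 // ez1 // ez2.
pose s := [seq stretches (l ij.1 ij.2) c | ij <- allpairs pair (iota 0 M) (iota 0 M)].
have szs : size s = M * M by rewrite size_map size_allpairs size_iota.
have : size s <= a * (tau + 2 * M).
  apply: linear_growth.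
    rewrite map_inj_in_uniq; last first.
      move=> [i j] [i' j'] /allpairsP[[u v] [/= uM vM [-> ->]]] {i j}.
      move=> /allpairsP[[u' v'] [/= uM' vM' [-> ->]]] {i' j'} eq_st.
      rewrite !mem_iota /= !add0n in uM vM uM' vM'.
      have st x : x \in c -> x.1 + extra_before (l u v) x.1 = x.1 + extra_before (l u' v') x.1.
        move=> /tnthP[r ->]; have /(congr1 (fun t => (tnth t r).1)) := eq_st.
        by rewrite !tnth_map.
      have := st p pc; have := st q qc; rewrite !eb.
      have -> : J1 < p.1 by lia.
      have -> : J2 < p.1 = false by lia.
      have -> : J3 < p.1 = false by lia.
      have -> : J4 < p.1 = false by lia.
      have -> : J1 < q.1 by lia.
      have -> : J2 < q.1 by lia.
      have -> : J3 < q.1 by lia.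
      have -> : J4 < q.1 = false by lia.
      by move: (E _) (E _) => *; congr pair; lia.
    by rewrite allpairs_uniq ?iota_uniq // => -[x y] [x' y'].
  move=> _ /mapP[[i j] /allpairsP[[u v] [/= uM vM [-> ->]]] ->].
  rewrite !mem_iota /= !add0n in uM vM; rewrite -(thick u v) //.
  by split; [apply: in_cells_stretch|rewrite stG // => x; apply: gap].
by rewrite szs {1}/M; nia.
Qed.

End OneCluster.

(** ** Cutting a block at the free cluster *)

(** Block [b] becomes two segments, of lengths [i] and [tau - i]. *)
Definition cut_types (b j : nat) : nat := if j <= b then j else j.-1.

Definition cut_lens (b i tau j : nat) : nat :=
  if j == b then i else if j == b.+1 then tau - i else tau.

Lemma segments_cut b i tau : b < 3 -> i <= tau ->
  segments 4 (cut_types b) (cut_lens b i tau) = blocks tau.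
Proof.
move=> b3 it; have e (x : nat) : nseq tau x = nseq i x ++ nseq (tau - i) x.
  by rewrite -nseqD subnKC.
case: b b3 => [|[|[|]]] // _; rewrite /blocks /segments /cut_lens /cut_types /= !cats0.
- by rewrite [nseq tau 0]e -?catA.
- by rewrite [nseq tau 1]e -?catA.
- by rewrite [nseq tau 2]e -?catA.
Qed.

Lemma landmark_cut b i tau l : b < 3 -> i <= tau -> l <= 4 ->
  landmark (cut_lens b i tau) l =
  if l <= b then l * tau else if l == b.+1 then b * tau + i else l.-1 * tau.
Proof.
move=> b3 it; case: b b3 => [|[|[|]]] // _; case: l => [|[|[|[|[|]]]]] // _;
  by rewrite /landmark ?big_ord_recl big_ord0 /cut_lens /=; lia.
Qed.

Lemma cut_lens_gt b i tau h j : h < i -> h < tau - i -> h < cut_lens b i tau j.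
Proof. by rewrite /cut_lens; case: ifP => // _; case: ifP => // _; lia. Qed.

Definition cut_anchor (b : nat) (p : descriptor) : descriptor :=
  (if p.1.1 <= b then p.1.1 else p.1.1.+1, p.1.2, p.2).

Lemma locate_cut_anchor K b i tau p : b < 3 -> i <= tau -> p.1.1 <= 3 ->
  locate K (cut_lens b i tau) (cut_anchor b p) = locate K (fun _ => tau) p.
Proof.
case: p => [[l c] x] /= b3 it l3; rewrite /locate /cut_anchor /=; congr (_ + _ - _, _).
rewrite landmark_const landmark_cut //; last by case: ifP; lia.
by case: (leqP l b) => [->//|lb]; rewrite !ifF //; lia.
Qed.

Lemma valid_cut_anchor N K b p : b < 3 ->
  valid_descriptor N K 3 p -> valid_descriptor N K 4 (cut_anchor b p).
Proof.
case: p => [[l c] x] /= b3 /and5P[/= l3 cK xL /implyP l0 /implyP lM].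
apply/and5P; split=> //=.
- by case: ifP; lia.
- by apply/implyP; case: ifP => // lb; lia.
- by apply/implyP; case: ifP => lb /eqP e; first lia; apply: lM; apply/eqP; lia.
Qed.

Definition widen (K K' : nat) (p : descriptor) : descriptor :=
  (p.1.1, p.1.2 + (K' - K), p.2).

Lemma locate_widen K K' n p : K <= K' -> locate K' n (widen K K' p) = locate K n p.
Proof.
move=> KK; rewrite /locate /widen /=; congr pair.
by rewrite addnA -[in X in _ - X](subnKC KK) subnDr.
Qed.

Lemma valid_widen N K K' m p : K <= K' ->
  valid_descriptor N K m p -> valid_descriptor N K' m (widen K K' p).
Proof.
case: p => [[l c] x] /= KK /and5P[/= l3 cK xL /implyP l0 /implyP lM].
apply/and5P; split=> //=.
- lia.
- by apply/implyP => /l0; lia.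
- by apply/implyP => /lM; lia.
Qed.

(** The centre is the cell of the first variable attached to the cut: this
    makes the description of an atom unique. *)
Definition centered (K b : nat) (s : seq descriptor) : bool :=
  if [seq p <- s | p.1.1 == b.+1] is p :: _ then p.1.2 == K else false.

Lemma tuple_choice (A B : eqType) k (t : k.-tuple A) (f : B -> A) (P : pred B) :
  (forall x, x \in t -> exists2 y, f y = x & P y) ->
  exists2 u : k.-tuple B, map_tuple f u = t & forall y, y \in u -> P y.
Proof.
move=> h; have /fin_all_exists[g hg] (r : 'I_k) : exists y, f y = tnth t r /\ P y.
  by have [y] := h _ (mem_tnth r t); exists y.
exists [tuple g r | r < k].
  by apply: eq_from_tnth => r; rewrite !(tnth_map, tnth_ord_tuple); have [] := hg r.
by move=> _ /mapP[r _ ->]; have [] := hg r.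
Qed.

Lemma locate_boundary N K tau (J x : nat) : J < 3 * tau -> x < cell_len N ->
  near_boundary K tau J ->
  exists2 p : descriptor, locate K (fun _ => tau) p = (J, x) & valid_descriptor N K 3 p.
Proof.
move=> Jt xL [b b3 /andP[h1 h2]]; exists (b, J + K - b * tau, x).
  by rewrite /locate /= landmark_const; congr pair; lia.
apply/and5P; split=> //=.
- lia.
- by apply/implyP => /eqP->; lia.
- by apply/implyP => /eqP e; rewrite e in h1 *; lia.
Qed.

Lemma near_boundary_widen K K' tau J : K <= K' ->
  near_boundary K tau J -> near_boundary K' tau J.
Proof. by move=> KK [b b3 h]; exists b => //; lia. Qed.

Section Shape.
Variables (N k a : nat) (G : seq nat -> k.-tuple (nat * nat) -> bool).
Hypothesis stG : stretch_stable N G.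
Hypothesis linear_growth : forall tau (s : seq (k.-tuple (nat * nat))), uniq s ->
  (forall c, c \in s -> in_cells N (blocks tau) c /\ G (blocks tau) c) ->
  size s <= a * tau.

Lemma near_boundaryP K tau J :
  reflect (near_boundary K tau J)
    [exists b : 'I_4, (b * tau <= J + K) && (J < b * tau + K)].
Proof.
apply: (iffP existsP) => [[b h]|[b b3 h]]; last by exists (inord b); rewrite inordK.
by exists b => //; have := ltn_ord b; lia.
Qed.

(** The variables far from the boundaries form a single cluster by
    [far_from_boundary_close]; the first of them fixes the place of the cut,
    unless it is so close to a boundary that no cut is necessary. *)
Lemma selected_shape K H tau (c : k.-tuple (nat * nat)) :
  k < K -> K.*2 < H -> in_cells N (blocks tau) c -> G (blocks tau) c ->
  (forall p : nat * nat, p \in c -> near_boundary (H + K) tau p.1) \/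
  exists (b i : nat) (d : k.-tuple descriptor),
    [/\ b < 3, H <= i, i + H <= tau,
        forall p, p \in d -> valid_descriptor N K 4 p &
        locates K (cut_lens b i tau) d = c /\ centered K b d].
Proof.
move=> kK KH inc Gc.
pose near (p : nat * nat) := [exists b : 'I_4, (b * tau <= p.1 + k) && (p.1 < b * tau + k)].
have nearP p : reflect (near_boundary k tau p.1) (near p) by apply: near_boundaryP.
case e : ([seq p <- c | ~~ near p] : seq (nat * nat)) => [|y s].
  left => p pc; apply: (@near_boundary_widen k); first lia.
  apply/nearP; case np: (near p) => //.
  have : p \in [seq p <- c | ~~ near p] by rewrite mem_filter np.
  by rewrite e.
have /andP[ny yc] : ~~ near y && (y \in c).
  by have := mem_head y s; rewrite -e mem_filter.
have close (p : nat * nat) : p \in c -> ~~ near p -> (p.1 <= y.1 + k) && (y.1 <= p.1 + k).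
  move=> pc /nearP np; move/nearP: ny => ny.
  case: (leqP p.1 y.1) => py.
    rewrite (leq_trans py) ?leq_addr //=.
    exact: (far_from_boundary_close stG linear_growth inc Gc).
  rewrite (leq_trans (ltnW py)) ?leq_addr // andbT.
  by apply: (far_from_boundary_close stG linear_growth inc Gc) => //; apply: ltnW.
have yt : y.1 < 3 * tau by have /andP[] := inc _ yc; rewrite size_blocks.
have tau0 : 0 < tau by case: (tau) yt; lia.
pose b := y.1 %/ tau; pose i := y.1 - b * tau.
have b3 : b < 3 by rewrite ltn_divLR.
have l1 : b * tau <= y.1 by apply: leq_divM.
have l2 : y.1 < b.+1 * tau by rewrite ltn_ceil.
have yi : y.1 = b * tau + i by rewrite subnKC.
have it : i < tau by rewrite mulSn in l2; lia.
case: (leqP H i) => [Hi|iH]; last first.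
  left => p pc; have [/nearP|np] := boolP (near p).
    by apply: near_boundary_widen; lia.
  exists b; first exact: ltnW.
  by have := close p pc np; lia.
case: (leqP (i + H) tau) => [iHt|tiH]; last first.
  left => p pc; have [/nearP|np] := boolP (near p).
    by apply: near_boundary_widen; lia.
  by exists b.+1 => //; have := close p pc np; rewrite mulSn in l2 *; lia.
right; exists b, i.
pose f (p : nat * nat) : descriptor :=
  if near p then
    let l := odflt ord0 [pick l : 'I_4 | (l * tau <= p.1 + k) && (p.1 < l * tau + k)] in
    cut_anchor b (l : nat, p.1 + K - l * tau, p.2)
  else (b.+1, p.1 + K - y.1, p.2).
have fP (p : nat * nat) : p \in c -> locate K (cut_lens b i tau) (f p) = p /\
    valid_descriptor N K 4 (f p).
  move=> pc; have := inc _ pc; rewrite size_blocks => /andP[pt px].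
  rewrite /f; case: ifP => np; last first.
    have /andP[c1 c2] := close p pc (negbT np).
    rewrite /locate /= landmark_cut //; [|exact: ltnW|by lia].
    rewrite ifF ?eqxx -?yi; last by lia.
    split; first by case: (p) c1 c2 {pc pt px np} => J x /= c1 c2; congr pair; lia.
    by rewrite /valid_descriptor /= px; lia.
  case: pickP => [l /andP[h1 h2]|h]; last first.
    by have /existsP[l] : is_true (near p) by []; rewrite h.
  rewrite /= locate_cut_anchor ?(ltnW it) //; last by rewrite /=; have := ltn_ord l; lia.
  split.
    rewrite /locate /= landmark_const; case: (p) h1 h2 {np pc pt px} => J x /= h1 h2.
    by congr pair; lia.
  apply: valid_cut_anchor => //; apply/and5P; split=> //=; first by have := ltn_ord l; lia.
  - by lia.
  - by apply/implyP => /eqP l0; rewrite l0 in h1 h2 *; lia.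
  - by apply/implyP => /eqP l0; rewrite l0 in h1 h2 *; lia.
exists (map_tuple f c); split=> //; first by move=> _ /mapP[p pc ->]; have [] := fP p pc.
split.
  by apply: val_inj; rewrite /= -map_comp map_id_in // => p /fP[].
rewrite /centered filter_map.
rewrite (@eq_filter _ _ (fun p => ~~ near p)) ?e /=; last first.
  move=> p; rewrite /= /f; case: ifP => _ /=; last exact: eqxx.
  by apply/negbTE; case: ifP; lia.
by rewrite /f (negPf ny) /= addKn.
Qed.

End Shape.

(** The reaches of distinct landmarks are disjoint. *)
Lemma locate_inj N K m n p p' : (forall j, j < m -> K.*2 < n j) ->
  valid_descriptor N K m p -> valid_descriptor N K m p' ->
  locate K n p = locate K n p' -> p = p'.
Proof.
case: p p' => [[l c] x] [[l' c'] x'] hn.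
have {}hn l1 l2 : l1 < l2 -> l2 <= m -> landmark n l1 + K.*2 < landmark n l2.
  move=> lt lm; have := hn l1 (leq_trans lt lm).
  by have := landmark_leq n lt; rewrite landmarkS; lia.
move=> /and5P[/= lm cK _ /implyP l0 _] /and5P[/= lm' cK' _ /implyP l0' _].
rewrite /locate /= => -[e ->].
have K0 l1 c1 : l1 <= m -> (l1 == 0 -> K <= c1) -> K <= landmark n l1 + c1.
  case: l1 => [|l1] l1m h; first by have := h isT; lia.
  by have := hn 0 l1.+1 isT l1m; lia.
have := K0 _ _ lm l0; have := K0 _ _ lm' l0'.
case: (ltngtP l l') => [lt|lt|el].
- by have := hn _ _ lt lm'; lia.
- by have := hn _ _ lt lm; lia.
- by rewrite el in e *; move=> h1 h2; congr (_, _, _); lia.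
Qed.

Lemma centeredP K b k (d : k.-tuple descriptor) : centered K b d ->
  exists2 r : 'I_k, (tnth d r).1 = (b.+1, K) &
    forall r' : 'I_k, r' < r -> (tnth d r').1.1 != b.+1.
Proof.
pose P (p : descriptor) := p.1.1 == b.+1; rewrite /centered -/P => h.
have hP : has P d by rewrite has_filter; case: [seq p <- d | P p] h.
have rk : find P d < k by rewrite -[X in _ < X](size_tuple d) -has_find.
pose x0 : descriptor := (0, 0, 0); exists (Ordinal rk).
  rewrite (tnth_nth x0) /=; have /eqP e := nth_find x0 hP.
  suff <- : (nth x0 d (find P d)).1.2 = K by rewrite -e; case: (nth _ _ _) => [[]].
  apply/eqP; move: h {rk e}; elim: (tval d) hP => //= p s IH.
  by rewrite -/(P p); case: (P p).
by move=> r' lt; rewrite (tnth_nth x0); apply: negbT; apply: (before_find x0 lt).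
Qed.

Lemma center_not_near K tau b i : b < 3 -> K < i -> i + K < tau ->
  ~ near_boundary K tau (b * tau + i).
Proof.
move=> b3 Ki it [l l3 /andP[h1 h2]]; case: (leqP l b) => lb.
  by have := leq_mul2r tau l b; rewrite lb orbT; lia.
by have := leq_mul2r tau b.+1 l; rewrite lb orbT mulSn; lia.
Qed.

Lemma locate_cut_near N K tau b i p : b < 3 -> i <= tau ->
  valid_descriptor N K 4 p -> p.1.1 != b.+1 ->
  near_boundary K tau (locate K (cut_lens b i tau) p).1.
Proof.
case: p => [[l c] x] /= b3 it /and5P[/= lm cK _ /implyP l0 _] lb.
exists (if l <= b then l else l.-1); first by case: ifP; lia.
rewrite landmark_cut //.
case: (leqP l b) => lb'; last rewrite (negPf lb).
  by case: (l) l0 => [/(_ isT)|l' _]; rewrite ?mul0n ?mulSn; lia.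
by case: (l) lb lb' => [|[|l']]; rewrite ?mulSn /=; lia.
Qed.

(** The variables attached to the cut are recognizable as those far from the
    boundaries, and the first of them reveals the place of the cut. *)
Lemma locates_cut_inj N K k tau b b' i i' (d d' : k.-tuple descriptor) :
  b < 3 -> b' < 3 -> K.*2 < i -> i + K.*2 < tau -> K.*2 < i' -> i' + K.*2 < tau ->
  (forall p, p \in d -> valid_descriptor N K 4 p) ->
  (forall p, p \in d' -> valid_descriptor N K 4 p) ->
  centered K b d -> centered K b' d' ->
  locates K (cut_lens b i tau) d = locates K (cut_lens b' i' tau) d' ->
  [/\ b = b', i = i' & d = d'].
Proof.
move=> b3 b3' Ki it Ki' it' vd vd' cd cd' e.
have er r : locate K (cut_lens b i tau) (tnth d r) =
    locate K (cut_lens b' i' tau) (tnth d' r).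
  by have := congr1 (fun t => tnth t r) e; rewrite !tnth_map.
have at_center b1 i1 (d1 : k.-tuple descriptor) r : b1 < 3 -> i1 < tau ->
    (tnth d1 r).1 = (b1.+1, K) ->
    (locate K (cut_lens b1 i1 tau) (tnth d1 r)).1 = b1 * tau + i1.
  move=> h1 h2 e1; rewrite /locate /= e1 landmark_cut //; [|exact: ltnW|by rewrite /=; lia].
  by rewrite /= ifF ?eqxx ?addnK //; lia.
have [r0 er0 lt0] := centeredP cd; have [r1 er1 lt1] := centeredP cd'.
have it0 : i < tau by lia.
have it0' : i' < tau by lia.
have r10 : r1 <= r0.
  rewrite leqNgt; apply/negP => /lt1 ne.
  have := locate_cut_near b3' (ltnW it0') (vd' _ (mem_tnth r0 d')) ne.
  by rewrite -er at_center //; apply: center_not_near => //; lia.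
have r01 : r0 <= r1.
  rewrite leqNgt; apply/negP => /lt0 ne.
  have := locate_cut_near b3 (ltnW it0) (vd _ (mem_tnth r1 d)) ne.
  by rewrite er at_center //; apply: center_not_near => //; lia.
have r0r1 : r0 = r1 by apply/val_inj/eqP; rewrite eqn_leq r01 r10.
have := congr1 fst (er r0); rewrite at_center // at_center ?r0r1 // => ebi.
have tau0 : 0 < tau by lia.
have eb : b = b'.
  by have := congr1 (divn^~ tau) ebi; rewrite /= !divnMDl // !divn_small // !addn0.
have ei : i = i' by move: ebi; rewrite eb => /addnI.
split=> //; apply: eq_from_tnth => r; rewrite -eb -ei in er.
apply: (locate_inj _ (vd _ (mem_tnth r d)) (vd' _ (mem_tnth r d')) (er r)) => j _.
by apply: cut_lens_gt; lia.
Qed.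

(** * Atoms of a presentation on words made of cells *)

Lemma fin_bound (X : finType) (P : X -> nat -> Prop) :
  (forall x, exists n0, forall n, n0 <= n -> P x n) ->
  exists n0, forall n, n0 <= n -> forall x, P x n.
Proof.
move=> /fin_all_exists[f hf]; exists (\max_x f x) => n hn x.
exact/hf/(leq_trans _ hn)/leq_bigmax.
Qed.

(** The cells for [N] are idempotent for all the formulas and rank sources of [p]
    at once. *)
Record tame (p : wrp_pres step step) (N : nat) : Prop := Tame {
  tame_sel : forall c : copy p, stretch_stable N
    (fun bs e => sat_at (cells N bs) (sel_formula c) (places N e));
  tame_label : forall (c : copy p) (g : step), stretch_stable N
    (fun bs e => sat_at (cells N bs) (label_formula c g) (places N e));
  tame_order : forall c c' : copy p, stretch_stable N
    (fun bs e => sat_at (cells N bs) (order_formula c c') (places N e));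
  tame_rank : forall (c : copy p) (r : 'I_(arity c)),
    #|state (source (wrp_rank c) r)| <= N
}.

Lemma tame_exists p : exists N, tame p N.
Proof.
have [n1 h1] := fin_bound (fun c : copy p => sat_at_stretch_stable (sel_formula c)).
have [n2 h2] := fin_bound (fun c : copy p =>
  fin_bound (fun g : step => sat_at_stretch_stable (label_formula c g))).
have [n3 h3] := fin_bound (fun c : copy p =>
  fin_bound (fun c' : copy p => sat_at_stretch_stable (order_formula c c'))).
have [n4 h4] : exists n0, forall n, n0 <= n -> forall (c : copy p) (r : 'I_(arity c)),
    #|state (source (wrp_rank c) r)| <= n.
  apply: fin_bound => c; apply: fin_bound => r.
  by exists #|state (source (wrp_rank c) r)|.
exists (maxn (maxn n1 n2) (maxn n3 n4)).
by split; [apply: h1|apply: h2|apply: h3|apply: h4]; lia.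
Qed.

Section Coordinates.
Variables (p : wrp_pres step step) (N : nat).

(** Atoms of different words become comparable once their positions are replaced
    with pairs of natural numbers. *)
Definition cell_atom : eqType := {c : copy p & (arity c).-tuple (nat * nat)}.

Definition cell_of (x : nat) : nat * nat := (x %/ cell_len N, x %% cell_len N).

Lemma place_cell_of x : place N (cell_of x) = x.
Proof. by rewrite /place /= -divn_eq. Qed.

Definition coords (w : seq step) (a : atom p w) : cell_atom :=
  Tagged (fun c => (arity c).-tuple (nat * nat))
    (map_tuple cell_of (map_tuple val (tagged a))).

Definition selN (bs : seq nat) (x : cell_atom) : bool :=
  sat_at (cells N bs) (sel_formula (tag x)) (places N (tagged x)).

Definition labelN (g : step) (bs : seq nat) (x : cell_atom) : bool :=
  sat_at (cells N bs) (label_formula (tag x) g) (places N (tagged x)).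

Definition chiN (bs : seq nat) (x y : cell_atom) : bool :=
  sat_at (cells N bs) (order_formula (tag x) (tag y))
    (places N (cat_tuple (tagged x) (tagged y))).

Definition rankN (bs : seq nat) (x : cell_atom) : 'rV[int]_(wrp_dim p) :=
  (rank_const (wrp_rank (tag x)) +
   \sum_(r < arity (tag x)) rank_at (@table _ _ _ (wrp_rank (tag x)) r)
      (cells N bs) (place N (tnth (tagged x) r)))%R.

Definition precN (bs : seq nat) (x y : cell_atom) : bool :=
  ltlex (rankN bs x) (rankN bs y) || (rankN bs x == rankN bs y) && chiN bs x y.

Lemma places_coords w (a : atom p w) :
  places N (tagged (coords a)) = map_tuple val (tagged a).
Proof.
by apply: eq_from_tnth => r; rewrite !tnth_map place_cell_of.
Qed.

Lemma coords_inj w : injective (@coords w).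
Proof.
case=> c x [c' x'] e.
have ec : c = c' by have := congr1 tag e.
move: x' e; rewrite -ec => x' /eqP; rewrite eq_Tagged => /eqP /(congr1 (@tval _ _)) /= e.
congr existT; apply: val_inj.
suff inj : injective (fun i : pos w => cell_of i).
  by apply: (inj_map inj); rewrite -!map_comp in e.
by move=> i j /(congr1 (place N)); rewrite !place_cell_of => /val_inj.
Qed.

Lemma letter_nth (w : seq step) (i : pos w) : letter i = nth U w i.
Proof. exact: tnth_nth. Qed.

Section Atoms.
Variable bs : seq nat.
Notation w := (cells N bs).
Implicit Types (a : atom p w) (x : cell_atom).

Lemma coords_in_cells a : in_cells N bs (tagged (coords a)).
Proof.
move=> _ /mapP[_ /mapP[i _ ->] ->]; rewrite /cell_of /=.
rewrite ltn_divLR ?cell_len_gt0 // -size_cells ltn_ord /=.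
by rewrite ltn_mod cell_len_gt0.
Qed.

Lemma coords_surj x : in_cells N bs (tagged x) -> exists a, coords a = x.
Proof.
case: x => c e /= inc; have [t et] := positions_of (place_lt inc).
exists (Tagged (fun c => (arity c).-tuple (pos w)) t); rewrite /coords /=; congr existT.
rewrite et; apply: val_inj; rewrite /= -map_comp map_id_in // => q /inc /andP[_ qL].
case: q qL => J y /= yL; rewrite /cell_of /place /=.
by rewrite divnMDl ?cell_len_gt0 // modnMDl modn_small // divn_small // addn0.
Qed.

Lemma selN_coords a : selN bs (coords a) = (a \in selected p w).
Proof. by rewrite /selN places_coords sat_at_val inE. Qed.

Lemma labelN_coords g a : labelN g bs (coords a) = has_label a g.
Proof. by rewrite /labelN places_coords sat_at_val. Qed.

Lemma chiN_coords a a' : chiN bs (coords a) (coords a') = chi a a'.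
Proof.
rewrite /chiN /chi -sat_at_val; congr sat_at; apply: val_inj.
rewrite /= !map_cat -!map_comp; congr (_ ++ _).
  by apply: eq_map => i /=; rewrite place_cell_of.
by apply: eq_map => i /=; rewrite place_cell_of.
Qed.

Lemma rankN_coords a : rankN bs (coords a) = atom_rank a.
Proof.
rewrite /rankN /atom_rank /rank_eval /=; congr (_ + _)%R; apply: eq_bigr => r _.
by rewrite !tnth_map place_cell_of letter_nth.
Qed.

Lemma precN_coords a a' : precN bs (coords a) (coords a') = prec a a'.
Proof. by rewrite /precN !rankN_coords chiN_coords. Qed.

End Atoms.

Section Affine.
Import GRing.Theory.
Local Open Scope ring_scope.

Definition attach (K : nat) (n : nat -> nat) (c : copy p)
    (d : (arity c).-tuple descriptor) : cell_atom :=
  Tagged (fun c => (arity c).-tuple (nat * nat)) (locates K n d).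

Hypothesis tameN : tame p N.

Lemma rankN_affine K m t (c : copy p) (d : (arity c).-tuple descriptor) :
  (forall q, q \in d -> valid_descriptor N K m q) ->
  exists r0 (r : nat -> 'rV[int]_(wrp_dim p)), forall n,
    (forall j, (j < m)%N -> (K.*2 < n j)%N) ->
    rankN (segments m t n) (attach K n d) = r0 + \sum_(j < m) r j *+ n j.
Proof.
move=> vd.
have /fin_all_exists[r0 /fin_all_exists[r hr]] (i : 'I_(arity c)) :=
  rank_at_segments (@table _ _ _ (wrp_rank c) i) t (tame_rank tameN i)
    (vd _ (mem_tnth i d)).
exists (rank_const (wrp_rank c) + \sum_i r0 i), (fun j => \sum_i r i j) => n hn.
rewrite /rankN /= -addrA; congr (_ + _).
under [X in _ + X]eq_bigr => j _ do rewrite -sumrMnl.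
rewrite exchange_big -big_split; apply: eq_bigr => i _ /=.
by rewrite tnth_map hr.
Qed.

Lemma selN_attach K m t n n' (c : copy p) (d : (arity c).-tuple descriptor) :
  (forall j, (j < m)%N -> (K.*2 < n j)%N) -> (forall j, (j < m)%N -> (K.*2 < n' j)%N) ->
  (forall q, q \in d -> valid_descriptor N K m q) ->
  selN (segments m t n) (attach K n d) = selN (segments m t n') (attach K n' d).
Proof.
move=> hn hn' vd; exact: (segments_stable t (@tame_sel _ _ tameN c) hn hn' vd).
Qed.

Lemma labelN_attach g K m t n n' (c : copy p) (d : (arity c).-tuple descriptor) :
  (forall j, (j < m)%N -> (K.*2 < n j)%N) -> (forall j, (j < m)%N -> (K.*2 < n' j)%N) ->
  (forall q, q \in d -> valid_descriptor N K m q) ->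
  labelN g (segments m t n) (attach K n d) = labelN g (segments m t n') (attach K n' d).
Proof.
move=> hn hn' vd; exact: (segments_stable t (@tame_label _ _ tameN c g) hn hn' vd).
Qed.

Lemma chiN_attach K m t n n' (c c' : copy p) (d : (arity c).-tuple descriptor)
    (d' : (arity c').-tuple descriptor) :
  (forall j, (j < m)%N -> (K.*2 < n j)%N) -> (forall j, (j < m)%N -> (K.*2 < n' j)%N) ->
  (forall q, q \in d -> valid_descriptor N K m q) ->
  (forall q, q \in d' -> valid_descriptor N K m q) ->
  chiN (segments m t n) (attach K n d) (attach K n d') =
  chiN (segments m t n') (attach K n' d) (attach K n' d').
Proof.
move=> hn hn' vd vd'.
have := segments_stable t (@tame_order _ _ tameN c c')
  hn hn' (c := cat_tuple d d').
have eloc n1 : locates K n1 (cat_tuple d d') = cat_tuple (locates K n1 d) (locates K n1 d').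
  by apply: val_inj; rewrite /= map_cat.
rewrite !eloc; apply=> q; rewrite mem_cat => /orP[]; [exact: vd|exact: vd'].
Qed.

End Affine.
End Coordinates.

(** * The lexicographic order on ranks *)

Section Lexicographic.
Import Order.TTheory GRing.Theory Num.Theory.
Local Open Scope ring_scope.
Variable d : nat.
Implicit Types u v w : 'rV[int]_d.

Lemma ltlexP u v :
  reflect (exists2 k : 'I_d, forall j : 'I_d, (j < k)%N -> u 0 j = v 0 j & u 0 k < v 0 k)
    (ltlex u v).
Proof.
apply: (iffP (Order.TupleLexiOrder.ltxi_tuplePlt _ _)) => -[k eqk ltk]; exists k.
- by move=> j /eqk; rewrite !tnth_mktuple.
- by move: ltk; rewrite !tnth_mktuple.
- by move=> j /eqk; rewrite !tnth_mktuple.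
- by rewrite !tnth_mktuple.
Qed.

Lemma ltlex_irr u : ltlex u u = false.
Proof. by rewrite /ltlex ltxx. Qed.

Lemma ltlex_trans u v w : ltlex u v -> ltlex v w -> ltlex u w.
Proof. exact: lt_trans. Qed.

Lemma ltlex_total u v : u != v -> ltlex u v || ltlex v u.
Proof.
move=> nuv; rewrite /ltlex -neq_lt; apply: contraNneq nuv => e.
apply/eqP/rowP => j; have := congr1 (fun t => tnth t j) e.
by rewrite !tnth_mktuple.
Qed.

Lemma ltlexD2r w u v : ltlex (u + w) (v + w) = ltlex u v.
Proof.
apply/ltlexP/ltlexP => -[k eqk ltk]; exists k.
- by move=> j /eqk; rewrite !mxE => /addIr.
- by move: ltk; rewrite !mxE ltrD2r.
- by move=> j /eqk; rewrite !mxE => ->.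
- by rewrite !mxE ltrD2r.
Qed.

Lemma ltlex_step u v : v != 0 -> ltlex (u + v) u || ltlex (u - v) u.
Proof.
move=> v0; have : u + v != u by rewrite -subr_eq0 addrC addKr.
move/ltlex_total => /orP[->//|]; rewrite -(ltlexD2r (- v)) addrK => ->.
by rewrite orbT.
Qed.

End Lexicographic.

(** * The first atom with a given label stays near a block boundary *)

(** Two cuts in block [b], at distance [h], carry two copies of the same atom. *)
Definition cut2_types (b j : nat) : nat :=
  if j <= b then j else if j <= b.+2 then b else j - 2.

Definition cut2_lens (b i h tau j : nat) : nat :=
  if j == b then i else if j == b.+1 then h else
  if j == b.+2 then tau - i - h else tau.

Lemma segments_cut2 b i h tau : b < 3 -> i + h <= tau ->
  segments 5 (cut2_types b) (cut2_lens b i h tau) = blocks tau.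
Proof.
move=> b3 it; have e (x : nat) : nseq tau x = nseq i x ++ nseq h x ++ nseq (tau - i - h) x.
  by rewrite -!nseqD; congr nseq; lia.
case: b b3 => [|[|[|]]] // _;
  rewrite /blocks /segments /cut2_lens /cut2_types /= !cats0 ?subn0.
- by rewrite [nseq tau 0]e -?catA.
- by rewrite [nseq tau 1]e -?catA.
- by rewrite [nseq tau 2]e -?catA.
Qed.

Lemma landmark_cut2 b i h tau l : b < 3 -> i + h <= tau -> l <= 5 ->
  landmark (cut2_lens b i h tau) l =
  if l <= b then l * tau else if l == b.+1 then b * tau + i else
  if l == b.+2 then b * tau + i + h else (l - 2) * tau.
Proof.
move=> b3 it; case: b b3 => [|[|[|]]] // _; case: l => [|[|[|[|[|[|]]]]]] // _;
  by rewrite /landmark ?big_ord_recl big_ord0 /cut2_lens /=; lia.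
Qed.

(** [cut_left] and [cut_right] attach the free cluster to the first and to the
    second of the two cuts. *)
Definition cut_left (b : nat) (p : descriptor) : descriptor :=
  (if p.1.1 <= b.+1 then p.1.1 else p.1.1.+1, p.1.2, p.2).

Definition cut_right (b : nat) (p : descriptor) : descriptor :=
  (if p.1.1 <= b then p.1.1 else p.1.1.+1, p.1.2, p.2).

Lemma locate_cut_left K b i h tau p : b < 3 -> i + h <= tau -> p.1.1 <= 4 ->
  locate K (cut2_lens b i h tau) (cut_left b p) = locate K (cut_lens b i tau) p.
Proof.
case: p => [[l c] x] /= b3 it l4; rewrite /locate /cut_left /=; congr (_ + _ - _, _).
rewrite landmark_cut // 1?landmark_cut2 //; [|by case: ifP; lia|by lia].
case: b b3 => [|[|[|]]] // _; case: l l4 => [|[|[|[|[|]]]]] //=; lia.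
Qed.

Lemma locate_cut_right K b i h tau p : b < 3 -> i + h <= tau -> p.1.1 <= 4 ->
  locate K (cut2_lens b i h tau) (cut_right b p) = locate K (cut_lens b (i + h) tau) p.
Proof.
case: p => [[l c] x] /= b3 it l4; rewrite /locate /cut_right /=; congr (_ + _ - _, _).
rewrite landmark_cut // 1?landmark_cut2 //; last by case: ifP; lia.
case: b b3 => [|[|[|]]] // _; case: l l4 => [|[|[|[|[|]]]]] //=; lia.
Qed.

Lemma valid_cut2 N K b p : b < 3 -> valid_descriptor N K 4 p ->
  valid_descriptor N K 5 (cut_left b p) && valid_descriptor N K 5 (cut_right b p).
Proof.
case: p => [[l c] x] /= b3 /and5P[/= l4 cK xL /implyP l0 /implyP lM].
rewrite /valid_descriptor /= cK xL /=.
case: b b3 => [|[|[|]]] // _; case: l l4 l0 lM => [|[|[|[|[|]]]]] //= _ l0 lM; lia.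
Qed.

Lemma cut_sum (V : nmodType) (r : nat -> V) b i tau : b < 3 -> i <= tau ->
  (\sum_(j < 4) r j *+ cut_lens b i tau j =
   r b *+ i + r b.+1 *+ (tau - i) + \sum_(j < 4 | (j != b :> nat) && (j != b.+1 :> nat)) r j *+ tau)%R.
Proof.
move=> b3 it; pose B : 'I_4 := inord b; pose B' : 'I_4 := inord b.+1.
have eB : B = b :> nat by rewrite inordK //; lia.
have eB' : B' = b.+1 :> nat by rewrite inordK //; lia.
rewrite (bigD1 B) //= (bigD1 B') /=; last by rewrite -val_eqE /= eB eB'; lia.
rewrite eB eB' {1 2}/cut_lens !eqxx ifF; last by lia.
rewrite GRing.addrA; congr (_ + _)%R.
apply: eq_big => j; first by rewrite -!val_eqE /= eB eB'.
by rewrite -!val_eqE /= eB eB' /cut_lens => /andP[/negPf-> /negPf->].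
Qed.

Section Anchored.
Variables (p : wrp_pres step step) (N K a : nat).
Hypothesis tameN : tame p N.
Hypothesis arityK : forall c : copy p, arity c < K.
Notation word tau := (cells N (blocks tau)).
Hypothesis linear_growth : forall tau, #|selected p (word tau)| <= a * tau.

Lemma linear_growth_copy (c : copy p) tau (s : seq ((arity c).-tuple (nat * nat))) :
  uniq s ->
  (forall e, e \in s -> in_cells N (blocks tau) e /\
     sat_at (word tau) (sel_formula c) (places N e)) ->
  size s <= a * tau.
Proof.
move=> us hs; apply: leq_trans (linear_growth tau).
pose f (e : (arity c).-tuple (nat * nat)) : cell_atom p :=
  Tagged (fun c => (arity c).-tuple (nat * nat)) e.
have -> : size s = size (map f s) by rewrite size_map.
rewrite cardE -(size_map (@coords p N _)); apply: uniq_leq_size.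
  by rewrite map_inj_uniq // => x y /eqP; rewrite eq_Tagged => /eqP.
move=> _ /mapP[e /hs[inc Ge] ->].
have [x ex] := @coords_surj p N (blocks tau) (f e) inc.
by rewrite -ex map_f // mem_enum -(selN_coords (N := N) x) ex.
Qed.

Definition attach_blocks (tau : nat) (c : copy p) (K' : nat)
    (d : (arity c).-tuple descriptor) : cell_atom p :=
  attach (p := p) K' (fun _ => tau) d.

Definition attach_cut (b i tau : nat) (c : copy p)
    (d : (arity c).-tuple descriptor) : cell_atom p :=
  attach (p := p) K (cut_lens b i tau) d.

Lemma selected_coords_shape H tau (x : atom p (word tau)) : K.*2 < H ->
  x \in selected p (word tau) ->
  (forall q : nat * nat, q \in tagged (coords N x) -> near_boundary (H + K) tau q.1) \/
  exists (b i : nat) (d : (arity (tag x)).-tuple descriptor),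
    [/\ b < 3, H <= i, i + H <= tau,
        forall q, q \in d -> valid_descriptor N K 4 q &
        coords N x = attach_cut b i tau d /\ centered K b d].
Proof.
move=> KH; rewrite -(selN_coords (N := N) x) => sx.
have [near|[b [i [d [h1 h2 h3 h4 [h5 h6]]]]]] :=
  selected_shape (@tame_sel _ _ tameN (tag x)) (@linear_growth_copy (tag x))
    (arityK (tag x)) KH (@coords_in_cells p N _ x) sx; first by left.
right; exists b, i, d; split=> //; split=> //.
by rewrite /attach_cut /attach h5.
Qed.

Lemma attach_cut_atom tau b i (c : copy p) (d : (arity c).-tuple descriptor) :
  b < 3 -> K.*2 < i -> i + K.*2 < tau ->
  (forall q, q \in d -> valid_descriptor N K 4 q) ->
  exists x : atom p (word tau), coords N x = attach_cut b i tau d.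
Proof.
move=> b3 Ki it vd; apply: (@coords_surj p N).
rewrite -(@segments_cut b i) //; last by lia.
by apply: locate_in_cells vd => j _; apply: cut_lens_gt; lia.
Qed.

Lemma near_boundary_attach tau K' (x : atom p (word tau)) :
  (forall q : nat * nat, q \in tagged (coords N x) -> near_boundary K' tau q.1) ->
  exists2 d : (arity (tag x)).-tuple descriptor,
    coords N x = attach_blocks tau K' d &
    forall q, q \in d -> valid_descriptor N K' 3 q.
Proof.
move=> near.
have [q qx|d ed vd] := @tuple_choice (nat * nat)%type descriptor _ (tagged (coords N x))
  (locate K' (fun _ => tau)) (valid_descriptor N K' 3).
  have /andP[qt qL] := coords_in_cells qx; rewrite size_blocks in qt.
  have [r er vr] := locate_boundary qt qL (near q qx); exists r => //.
  by rewrite er -surjective_pairing.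
exists d => //; rewrite /attach_blocks /attach /locates ed.
by case: (x).
Qed.

Section Moves.
Variables (b tau : nat) (c : copy p) (d : (arity c).-tuple descriptor).
Hypothesis b3 : b < 3.
Hypothesis vd : forall q, q \in d -> valid_descriptor N K 4 q.

Let lens_ok i j : K.*2 < i -> i + K.*2 < tau -> j < 4 -> K.*2 < cut_lens b i tau j.
Proof. by move=> h1 h2 _; apply: cut_lens_gt; lia. Qed.

Lemma selN_move i j : K.*2 < i -> i + K.*2 < tau -> K.*2 < j -> j + K.*2 < tau ->
  selN N (blocks tau) (attach_cut b i tau d) = selN N (blocks tau) (attach_cut b j tau d).
Proof.
move=> h1 h2 h3 h4; rewrite -{1}(@segments_cut b i) //; last by lia.
rewrite -(@segments_cut b j tau) //; last by lia.
by apply: selN_attach => // l; apply: lens_ok.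
Qed.

Lemma labelN_move g i j : K.*2 < i -> i + K.*2 < tau -> K.*2 < j -> j + K.*2 < tau ->
  labelN N g (blocks tau) (attach_cut b i tau d) =
  labelN N g (blocks tau) (attach_cut b j tau d).
Proof.
move=> h1 h2 h3 h4; rewrite -{1}(@segments_cut b i) //; last by lia.
rewrite -(@segments_cut b j tau) //; last by lia.
by apply: labelN_attach => // l; apply: lens_ok.
Qed.

Lemma rankN_move : exists v : 'rV[int]_(wrp_dim p),
  forall i, K.*2 < i -> i.+1 + K.*2 < tau ->
    rankN N (blocks tau) (attach_cut b i.+1 tau d) =
    (rankN N (blocks tau) (attach_cut b i tau d) + v)%R.
Proof.
have [r0 [r hr]] := rankN_affine (m := 4) tameN (cut_types b) vd.
exists (r b - r b.+1)%R => i h1 h2; rewrite -{1}(@segments_cut b i.+1 tau) //; last by lia.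
rewrite -{1}(@segments_cut b i tau) //; last by lia.
rewrite !hr; [|by move=> j; apply: lens_ok; lia|by move=> j; apply: lens_ok; lia].
rewrite !cut_sum //; [|by lia|by lia].
rewrite (_ : tau - i = (tau - i.+1).+1); last by lia.
rewrite !GRing.mulrSr.
move: (r b *+ i)%R (r b.+1 *+ _)%R (\sum_(_ < 4 | _) _)%R => A B C.
by apply/rowP => j; rewrite !mxE; ring.
Qed.

Lemma chiN_move h i j : K.*2 < h -> K.*2 < i -> i + h + K.*2 < tau ->
  K.*2 < j -> j + h + K.*2 < tau ->
  chiN N (blocks tau) (attach_cut b i tau d) (attach_cut b (i + h) tau d) =
  chiN N (blocks tau) (attach_cut b j tau d) (attach_cut b (j + h) tau d).
Proof.
move=> h0 h1 h2 h3 h4.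
have vd4 q : q \in d -> q.1.1 <= 4 by move=> /vd /and5P[].
have eqs i' : i' + h + K.*2 < tau ->
    attach_cut b i' tau d = attach (p := p) K (cut2_lens b i' h tau) (map_tuple (cut_left b) d)
 /\ attach_cut b (i' + h) tau d =
      attach (p := p) K (cut2_lens b i' h tau) (map_tuple (cut_right b) d).
  move=> hi; split; congr existT; apply: val_inj; rewrite /= -map_comp;
    apply/eq_in_map => q /vd4 q4 /=.
    by rewrite locate_cut_left //; lia.
  by rewrite locate_cut_right //; lia.
have [-> ->] := eqs i h2; have [-> ->] := eqs j h4.
rewrite -{1}(@segments_cut2 b i h tau) //; last by lia.
rewrite -(@segments_cut2 b j h tau) //; last by lia.
have ok i' j' : K.*2 < i' -> i' + h + K.*2 < tau -> j' < 5 ->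
    K.*2 < cut2_lens b i' h tau j'.
  by move=> g1 g2 _; rewrite /cut2_lens; do 3?[case: ifP => // _]; lia.
apply: chiN_attach => //.
- by move=> l; apply: ok.
- by move=> l; apply: ok.
- by move=> _ /mapP[q /vd vq ->]; have /andP[] := valid_cut2 b3 vq.
- by move=> _ /mapP[q /vd vq ->]; have /andP[] := valid_cut2 b3 vq.
Qed.

End Moves.

(** If ranks vary along the cut, moving by one cell in one of the two
    directions lowers the rank; otherwise the order formula decides, and it
    cannot tell a move to the left from an equally long move to the right. *)
Lemma minimal_near_boundary g tau (x : atom p (word tau)) :
  x \in selected p (word tau) -> has_label x g ->
  (forall y : atom p (word tau), y \in selected p (word tau) -> has_label y g ->
     ~~ prec y x) ->
  exists2 d : (arity (tag x)).-tuple descriptor,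
    coords N x = attach_blocks tau (5 * K + 3) d &
    forall q, q \in d -> valid_descriptor N (5 * K + 3) 3 q.
Proof.
move=> sx lx minx.
have [|near|[b [i [d [b3 Hi iH vd [ex cd]]]]]] := @selected_coords_shape (4 * K + 3) tau x _ sx.
- by lia.
- by apply: near_boundary_attach => q /near; apply: near_boundary_widen; lia.
exfalso.
(* The cluster may move by [h] in both directions and stay clear of the
   boundaries; [h] itself must allow two cuts at distance [h]. *)
have [h [h0 ih ih2 ihh ihi]] : exists h, [/\ K.*2 < h, K.*2 < i - h,
    i - h + h + K.*2 < tau, i + h + K.*2 < tau & i - h + h = i].
  by exists K.*2.+1; split; lia.
have [Ki it Ki1 it1 i0] : [/\ K.*2 < i, i + K.*2 < tau, K.*2 < i.-1,
    i.+1 + K.*2 < tau & 0 < i] by split; lia.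
have [Kih Kih0 itm Ki2 it0] : [/\ K.*2 < i + h, i - h + K.*2 < tau, i.-1 + K.*2 < tau,
    K.*2 < i.+1 & i < i + h] by split; lia.
clear Hi iH.
rewrite -(selN_coords (N := N)) ex in sx; rewrite -(labelN_coords (N := N)) ex in lx.
have move_to j : K.*2 < j -> j + K.*2 < tau -> exists y : atom p (word tau),
    [/\ coords N y = attach_cut b j tau d, y \in selected p (word tau) & ~~ prec y x].
  move=> h1 h2; have [y ey] := attach_cut_atom b3 h1 h2 vd; exists y.
  have sy : y \in selected p (word tau).
    by rewrite -(selN_coords (N := N)) ey (@selN_move b tau _ d b3 vd j i).
  have ly : has_label y g.
    by rewrite -(labelN_coords (N := N)) ey (@labelN_move b tau _ d b3 vd g j i).
  by split=> //; apply: minx.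
have sx' : x \in selected p (word tau) by rewrite -(selN_coords (N := N)) ex.
have [v hv] := @rankN_move b tau _ d b3 vd.
have [v0|v0] := eqVneq v 0%R; last first.
  have [y [ey _ py]] := move_to i.+1 Ki2 it1.
  have [z [ez _ pz]] := move_to i.-1 Ki1 itm.
  have /orP[lt|lt] := ltlex_step (rankN N (blocks tau) (coords N x)) v0.
    by move: py; rewrite -(precN_coords (N := N)) /precN ey hv // -ex lt.
  move: pz; rewrite -(precN_coords (N := N)) /precN ez.
  have := hv i.-1 Ki1; rewrite prednK // => /(_ it).
  rewrite -ex => er; rewrite (_ : rankN N (blocks tau) (attach_cut b i.-1 tau d) =
    rankN N (blocks tau) (coords N x) - v)%R ?lt //.
  by rewrite er GRing.addrK.
rewrite {}v0 in hv.
have rank_eq j m : K.*2 < j -> j + m + K.*2 < tau ->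
    rankN N (blocks tau) (attach_cut b (j + m) tau d) =
    rankN N (blocks tau) (attach_cut b j tau d).
  move=> h1; elim: m => [|m IH] h2; first by rewrite addn0.
  rewrite addnS in h2 *; rewrite hv // ?GRing.addr0 ?IH //; first exact: ltnW.
  exact: leq_trans h1 (leq_addr _ _).
(* The rank is constant along the cut: compare with the moves by [h]. *)
have [y [ey sy py]] := move_to (i - h) ih Kih0.
have [z [ez sz pz]] := move_to (i + h) Kih ihh.
have chi_yx : ~~ chi y x.
  apply: contra py => cyx; rewrite /prec cyx andbT -!(rankN_coords (N := N)) ey ex.
  by rewrite -[in X in _ == X]ihi rank_eq // eqxx orbT.
have chi_xz : ~~ chi x z.
  rewrite -(chiN_coords (N := N)) ex ez (@chiN_move b tau _ d b3 vd h i (i - h)) //.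
  by rewrite ihi -ey -ex chiN_coords.
have chi_zx : ~~ chi z x.
  apply: contra pz => czx; rewrite /prec czx andbT -!(rankN_coords (N := N)) ez ex.
  by rewrite rank_eq // eqxx orbT.
have xz : x != z.
  apply/eqP => exz; move: ez; rewrite -exz ex => /eqP; rewrite eq_Tagged => /eqP e.
  have [_ ei _] := locates_cut_inj b3 b3 Ki it Kih ihh vd vd cd cd e.
  by rewrite -ei ltnn in it0.
have := @chi_total _ _ (wrp_polyreg p) _ x z sx' sz xz.
by rewrite (negPf chi_xz) (negPf chi_zx).
Qed.

End Anchored.

(** * Counting along a line: rational slopes *)

(** [g n] equals [z / q * n] up to a bounded error, for large [n]. *)
Definition rational_slope (g : nat -> nat) : Prop :=
  exists q z B n0, 0 < q /\ forall n, n0 <= n ->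
    q * g n <= z * n + B /\ z * n <= q * g n + B.

Lemma rational_slope_close C n1 g g' :
  (forall n, n1 <= n -> g n <= g' n + C /\ g' n <= g n + C) ->
  rational_slope g -> rational_slope g'.
Proof.
move=> hC [q [z [B [n0 [q0 hg]]]]]; exists q, z, (B + q * C), (n0 + n1); split=> // n hn.
have [h1 h2] := hg n ltac:(lia); have [h3 h4] := hC n ltac:(lia).
have h5 : q * g n <= q * (g' n + C) by rewrite leq_mul2l h3 orbT.
have h6 : q * g' n <= q * (g n + C) by rewrite leq_mul2l h4 orbT.
by rewrite !mulnDr in h5 h6; lia.
Qed.

Lemma rational_slope0 : rational_slope (fun=> 0).
Proof. by exists 1, 0, 0, 0; split=> // n _; lia. Qed.

Lemma rational_slopeD g g' : rational_slope g -> rational_slope g' ->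
  rational_slope (fun n => g n + g' n).
Proof.
move=> [q [z [B [n0 [q0 hg]]]]] [q' [z' [B' [n0' [q0' hg']]]]].
exists (q * q'), (z * q' + z' * q), (B * q' + B' * q), (n0 + n0'); split.
  by rewrite muln_gt0 q0.
move=> n hn; have [h1 h2] := hg n ltac:(lia); have [h3 h4] := hg' n ltac:(lia).
have := leq_mul (leqnn q') h1; have := leq_mul (leqnn q') h2.
have := leq_mul (leqnn q) h3; have := leq_mul (leqnn q) h4.
by nia.
Qed.

Lemma rational_slope_sum (I : Type) (s : seq I) (g : I -> nat -> nat) :
  (forall i, rational_slope (g i)) -> rational_slope (fun n => \sum_(i <- s) g i n).
Proof.
move=> hg; elim: s => [|i s IH].
  by apply: (@rational_slope_close 0 0) rational_slope0 => n _; rewrite big_nil.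
apply: (@rational_slope_close 0 0) (rational_slopeD (hg i) IH) => n _.
by rewrite big_cons addn0.
Qed.

Section HalfPlane.
Import Order.TTheory GRing.Theory Num.Theory.

Lemma count_lt M n : count (fun i => i < M) (iota 0 n) = minn M n.
Proof.
elim: n => [|n IH]; first by rewrite minn0.
by rewrite -addn1 iotaD count_cat IH /= add0n; lia.
Qed.

Lemma halfplane_threshold (X : nat) (v : int) : 0 < X -> exists M : nat,
  (forall i : nat, (X%:Z * i%:Z < v)%R = (i < M)) /\
  ((M = 0 /\ (v <= 0)%R) \/
   (0 < M /\ (X%:Z * M%:Z < v + X%:Z)%R /\ (v <= X%:Z * M%:Z)%R)).
Proof.
move=> X0; case: v => [v|v]; last first.
  exists 0; split; last by left; split=> //; lia.
  move=> i; have h : (0 <= X%:Z * i%:Z)%R by rewrite mulr_ge0.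
  by apply/idP/idP; lia.
case: v => [|v].
  exists 0; split; last by left; split=> //; lia.
  move=> i; have h : (0 <= X%:Z * i%:Z)%R by rewrite mulr_ge0.
  by apply/idP/idP; lia.
exists (v %/ X).+1; split.
  by move=> i; rewrite -PoszM ltz_nat !ltnS mulnC leq_divRL.
right; split=> //; rewrite -!PoszM -PoszD ltz_nat lez_nat mulnC mulSn.
have := leq_divM v X; have := ltn_ceil v X0; rewrite mulSn; lia.
Qed.

(** The solutions form an initial interval, whose end grows with slope [- x2 / X]
    truncated to the range from 0 to 1. *)
Lemma halfplane_pos (x0 x2 : int) (X : nat) : 0 < X ->
  rational_slope (fun n =>
    count (fun i : nat => (x0 + X%:Z * i%:Z + x2 * n%:Z < 0)%R) (iota 0 n)).
Proof.
move=> X0; pose z : nat := if (0 <= x2)%R then 0 else minn X `|x2|%N.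
exists X, z, (`|x0| + X)%N, 0; split=> // n _.
have [M [hM cM]] := halfplane_threshold (- x0 - x2 * n%:Z)%R X0.
have -> : count (fun i : nat => (x0 + X%:Z * i%:Z + x2 * n%:Z < 0)%R) (iota 0 n) = minn M n.
  by rewrite -count_lt; apply: eq_count => i; rewrite -hM; apply/idP/idP; lia.
rewrite /z; case: (leP 0%R x2) => hx2.
  have p0 : (0 <= x2 * n%:Z)%R by rewrite mulr_ge0.
  have h : X * minn M n <= X * M by rewrite leq_mul2l geq_minl orbT.
  by case: cM => [[M0 _]|[_ [c1 _]]]; [rewrite M0; lia|lia].
have [y ey] : exists y : nat, x2 = (- y%:Z)%R by exists `|x2|%N; lia.
have -> : `|x2|%N = y by lia.
rewrite ey mulNr opprK -PoszM in cM.
case: (leqP X y) => hXy.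
  have : X * n <= y * n by rewrite leq_mul2r hXy orbT.
  case: (leqP M n) => hMn; last by lia.
  have : X * M <= X * n by rewrite leq_mul2l hMn orbT.
  by case: cM => [[M0 c1]|[_ [c1 c2]]]; [rewrite M0 muln0; lia|lia].
have : y * n <= X * n by rewrite leq_mul2r (ltnW hXy) orbT.
case: (leqP M n) => hMn; case: cM => [[M0 c1]|[_ [c1 c2]]].
- by rewrite M0 muln0; lia.
- by lia.
- by lia.
- have : X * n <= X * M by rewrite leq_mul2l (ltnW hMn) orbT.
  lia.
Qed.

Lemma halfplane_slope (x0 x1 x2 : int) :
  rational_slope (fun n =>
    count (fun i : nat => (x0 + x1 * i%:Z + x2 * n%:Z < 0)%R) (iota 0 n)).
Proof.
case: (ltrgtP x1 0%R) => hx1.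
- have [X eX] : exists X : nat, x1 = (- X%:Z)%R by exists `|x1|%N; lia.
  have X0 : 0 < X by lia.
  (* The reflection of [i] to [n - 1 - i] makes the coefficient positive. *)
  apply: (@rational_slope_close 0 0) (halfplane_pos (x0 - x1)%R (x1 + x2)%R X0) => n _.
  suff -> : count (fun i : nat => (x0 - x1 + X%:Z * i%:Z + (x1 + x2) * n%:Z < 0)%R) (iota 0 n)
      = count (fun i : nat => (x0 + x1 * i%:Z + x2 * n%:Z < 0)%R) (iota 0 n) by lia.
  rewrite -[RHS]count_rev (_ : rev (iota 0 n) = [seq n.-1 - i | i <- iota 0 n]); last first.
    apply: (@eq_from_nth _ 0); first by rewrite size_rev size_map.
    move=> j; rewrite size_rev size_iota => jn.
    by rewrite nth_rev ?size_iota // (nth_map 0) ?size_iota // !nth_iota //; lia.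
  rewrite count_map; apply: eq_in_count => i; rewrite mem_iota add0n => /andP[_ iN] /=.
  have -> : ((n.-1 - i)%N%:Z = n%:Z - 1 - i%:Z)%R by lia.
  by congr (_ < _)%R; rewrite eX; ring.
- have [X eX] : exists X : nat, x1 = X%:Z%R by exists `|x1|%N; lia.
  by rewrite eX; apply: halfplane_pos; lia.
- have all_count n : (forall i : nat, (x0 + x1 * i%:Z + x2 * n%:Z < 0)%R) ->
      count (fun i : nat => (x0 + x1 * i%:Z + x2 * n%:Z < 0)%R) (iota 0 n) = n.
    by move=> h; rewrite (eq_count (a2 := predT)) ?count_predT ?size_iota.
  have no_count n : (forall i : nat, (x0 + x1 * i%:Z + x2 * n%:Z < 0)%R = false) ->
      count (fun i : nat => (x0 + x1 * i%:Z + x2 * n%:Z < 0)%R) (iota 0 n) = 0.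
    by move=> h; rewrite (eq_count (a2 := pred0)) ?count_pred0.
  case: (ltrgtP x2 0%R) => hx2.
  + exists 1, 1, 0, `|x0|.+1; split=> // n hn.
    by rewrite all_count; [lia|move=> i; nia].
  + exists 1, 0, 0, `|x0|.+1; split=> // n hn.
    by rewrite no_count; [lia|move=> i; nia].
  + case: (ltP x0 0%R) => hx0.
      by exists 1, 1, 0, 0; split=> // n _; rewrite all_count; [lia|move=> i; nia].
    by exists 1, 0, 0, 0; split=> // n _; rewrite no_count; [lia|move=> i; nia].
Qed.

End HalfPlane.

Section LexCount.
Import Order.TTheory GRing.Theory Num.Theory.
Variable d : nat.

(** The first coordinate on which the affine vector is not identically zero
    decides its sign, wherever that coordinate does not vanish. *)
Lemma lex_affine (X0 X1 X2 : 'rV[int]_d) :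
  [/\ X0 = 0, X1 = 0 & X2 = 0]%R \/
  exists x0 x1 x2 : int, ~~ [&& x0 == 0, x1 == 0 & x2 == 0]%R /\
    forall n i : nat, (x0 + x1 * i%:Z + x2 * n%:Z != 0)%R ->
      ltlex (X0 + X1 *+ i + X2 *+ n)%R 0%R = (x0 + x1 * i%:Z + x2 * n%:Z < 0)%R /\
      (X0 + X1 *+ i + X2 *+ n != 0)%R.
Proof.
pose nz (k : nat) := [exists j : 'I_d, (j == k :> nat) &&
  ~~ [&& X0 0%R j == 0, X1 0%R j == 0 & X2 0%R j == 0]%R].
case: (boolP [exists j : 'I_d, nz j]) => [/existsP[j0 nz0]|]; last first.
  rewrite negb_exists => /forallP nnz; left.
  have h j : [&& X0 0%R j == 0, X1 0%R j == 0 & X2 0%R j == 0]%R.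
    apply: contraNT (nnz j) => hj; apply/existsP; exists j.
    by rewrite eqxx hj.
  by split; apply/rowP => j; have /and3P[/eqP h0 /eqP h1 /eqP h2] := h j; rewrite ?h0 ?h1 ?h2 mxE.
case: (ex_minnP (ex_intro nz _ nz0)) => k /existsP[K /andP[/eqP eK nzK]] kmin.
have before (j : 'I_d) : j < K -> [/\ X0 0%R j = 0, X1 0%R j = 0 & X2 0%R j = 0]%R.
  move=> jK; suff /and3P[/eqP-> /eqP-> /eqP->] :
    [&& X0 0%R j == 0, X1 0%R j == 0 & X2 0%R j == 0]%R by [].
  apply: contraTT jK => hj; rewrite -leqNgt eK; apply: kmin.
  by apply/existsP; exists j; rewrite eqxx.
right; exists (X0 0%R K), (X1 0%R K), (X2 0%R K); split=> // n i.
set s := (_ + _ * _ + _ * _)%R => s0.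
pose D := (X0 + X1 *+ i + X2 *+ n)%R; rewrite -/D.
have DE j : D 0%R j = (X0 0 j + X1 0 j * i%:Z + X2 0 j * n%:Z)%R.
  have mulE (y : int) (l : nat) : (y *+ l = y * l%:Z)%R by rewrite -mulr_natr natz.
  by rewrite /D !mxE !mulmxnE !mulE.
have DK : D 0%R K = s by rewrite DE.
have D0 (j : 'I_d) : j < K -> D 0%R j = 0%R.
  by move=> /before[h0 h1 h2]; rewrite DE h0 h1 h2 !mul0r !addr0.
split; last by apply: contraNneq s0 => eD; rewrite -DK eD mxE.
apply/ltlexP/idP => [[j eqj ltj]|s_neg].
  case: (ltngtP j K) => [jK|Kj|/val_inj jK].
  - by move: ltj; rewrite D0 // mxE ltxx.
  - by move: s0; rewrite -DK eqj // mxE eqxx.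
  - by move: ltj; rewrite jK DK mxE.
by exists K => [j jK|]; [rewrite D0 // mxE|rewrite DK mxE].
Qed.

Lemma count_zero_le1 (x0 x1 x2 : int) n : ~~ [&& x0 == 0, x1 == 0 & x2 == 0]%R ->
  `|x0| < n ->
  count (fun i : nat => (x0 + x1 * i%:Z + x2 * n%:Z == 0)%R) (iota 0 n) <= 1.
Proof.
move=> nz hn; rewrite -size_filter.
have : uniq [seq i <- iota 0 n | (x0 + x1 * i%:Z + x2 * n%:Z == 0)%R].
  by rewrite filter_uniq ?iota_uniq.
case E : [seq _ <- _ | _] => [|i [|j s]] // /=; rewrite inE negb_or => /andP[/andP[nij _] _].
have zero l : l \in [:: i, j & s] -> (x0 + x1 * l%:Z + x2 * n%:Z = 0)%R.
  by rewrite -E mem_filter => /andP[/eqP].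
have hi := zero i ltac:(by rewrite inE eqxx).
have hj := zero j ltac:(by rewrite !inE eqxx orbT).
have x10 : (x1 * (i%:Z - j%:Z) = 0)%R.
  by rewrite mulrBr; lia.
move/eqP: x10; rewrite mulf_eq0 subr_eq0 => /orP[/eqP x10|/eqP e]; last first.
  by move/eqP: nij; case; lia.
exfalso; rewrite x10 mul0r addr0 in hi.
case: (eqVneq x2 0%R) => x20; last by nia.
by move: nz; rewrite x10 x20 in hi *; rewrite (_ : x0 = 0%R) ?eqxx //; lia.
Qed.

Lemma count_diff (T : Type) (P P' Q : pred T) (s : seq T) :
  (forall x, P x != P' x -> Q x) -> count P s <= count P' s + count Q s.
Proof.
move=> h; elim: s => //= x s IH; have := h x.
by case: (P x); case: (P' x); case: (Q x) => //= hx; rewrite ?(leqW IH) //; try lia; have := hx isT.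
Qed.

(** The boolean [c] decides the ties: either they are exceptional, or the vector
    vanishes identically. *)
Lemma affine_lex_slope (X0 X1 X2 : 'rV[int]_d) (c : bool) (H : nat) :
  rational_slope (fun n => count (fun i : nat => [&& H <= i, i + H <= n &
    ltlex (X0 + X1 *+ i + X2 *+ n)%R 0%R || (X0 + X1 *+ i + X2 *+ n == 0)%R && c])
    (iota 0 n)).
Proof.
have [x0 [x1 [x2 [n1 [C hC]]]]] : exists (x0 x1 x2 : int) (n1 C : nat), forall n, n1 <= n ->
   exists2 Q : pred nat, count Q (iota 0 n) <= C & forall i, ~~ Q i ->
     ltlex (X0 + X1 *+ i + X2 *+ n)%R 0%R || (X0 + X1 *+ i + X2 *+ n == 0)%R && c
     = (x0 + x1 * i%:Z + x2 * n%:Z < 0)%R.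
  have [[-> -> ->]|[x0 [x1 [x2 [nz hx]]]]] := lex_affine X0 X1 X2.
    exists (if c then -1 else 0)%R, 0%R, 0%R, 0, 0 => n _; exists pred0; rewrite ?count_pred0 //.
    by move=> i _; rewrite !mul0rn !mul0r !addr0 ltlex_irr eqxx /=; case: c.
  exists x0, x1, x2, `|x0|.+1, 1 => n hn.
  exists (fun i : nat => (x0 + x1 * i%:Z + x2 * n%:Z == 0)%R).
    exact: count_zero_le1.
  by move=> i /hx[-> /negPf->]; rewrite orbF.
apply: (@rational_slope_close (C + 2 * H) n1) (halfplane_slope x0 x1 x2) => n hn.
have [Q cQ hQ] := hC n hn.
pose R i := Q i || (i < H) || (n < i + H).
have cR : count R (iota 0 n) <= C + 2 * H.
  have h1 : count (fun i => i < H) (iota 0 n) <= H by rewrite count_lt geq_minl.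
  have h2 : count (fun i => n < i + H) (iota 0 n) <= H.
    have := count_predC (fun i => i < n.+1 - H) (iota 0 n).
    rewrite count_lt size_iota => e; have -> : count (fun i => n < i + H) (iota 0 n) =
      count (predC (fun i => i < n.+1 - H)) (iota 0 n).
      by apply: eq_count => i /=; lia.
    by lia.
  have h3 := count_diff (P := R) (P' := fun i => Q i || (i < H)) (Q := fun i => n < i + H) (iota 0 n).
  have h4 := count_diff (P := fun i => Q i || (i < H)) (P' := Q) (Q := fun i => i < H) (iota 0 n).
  have {}h3 := h3 _; have {}h4 := h4 _.
  apply: leq_trans (h3 _) _; first by move=> i; rewrite /R; case: (n < i + H); rewrite ?orbF ?eqxx.
  have := h4 ltac:(by move=> i; case: (i < H); rewrite ?orbF ?eqxx); lia.
have hR i : ~~ R i -> [&& H <= i, i + H <= n &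
    ltlex (X0 + X1 *+ i + X2 *+ n)%R 0%R || (X0 + X1 *+ i + X2 *+ n == 0)%R && c]
    = (x0 + x1 * i%:Z + x2 * n%:Z < 0)%R.
  by rewrite /R !negb_or -!leqNgt => /andP[/andP[/hQ-> ->] ->].
have key (P P' : pred nat) : (forall i, P i != P' i -> R i) ->
    count P (iota 0 n) <= count P' (iota 0 n) + (C + 2 * H).
  by move=> h; apply: leq_trans (count_diff _ h) _; rewrite leq_add2l.
by split; apply: key => i; apply: contraR => /hR->.
Qed.

End LexCount.

(** * Counting the atoms that precede an anchored atom *)

Section Count.
Variables (p : wrp_pres step step) (N K a : nat).
Hypothesis tameN : tame p N.
Hypothesis arityK : forall c : copy p, arity c < K.
Notation word tau := (cells N (blocks tau)).
Hypothesis linear_growth : forall tau, #|selected p (word tau)| <= a * tau.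

Definition code (m K' : nat) : finType := ('I_m.+1 * 'I_K'.*2 * 'I_(cell_len N))%type.

Definition decode m K' (q : code m K') : descriptor :=
  (q.1.1 : nat, q.1.2 : nat, q.2 : nat).

Definition decodes m K' k (t : k.-tuple (code m K')) : k.-tuple descriptor :=
  map_tuple (@decode m K') t.

Lemma decodes_inj m K' k : injective (@decodes m K' k).
Proof.
move=> t t' /(congr1 val) /= /(inj_map _) e; apply: val_inj; apply: e.
by move=> [[x y] z] [[x' y'] z'] [/val_inj-> /val_inj-> /val_inj->].
Qed.

Lemma decodes_surj m K' k (d : k.-tuple descriptor) :
  (forall q, q \in d -> valid_descriptor N K' m q) ->
  exists t, @decodes m K' k t = d.
Proof.
move=> vd; have [[[l c] x] qd|t et _] := @tuple_choice _ _ _ d (@decode m K') predT; last by exists t.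
have /and5P[/= h1 h2 h3 _ _] := vd _ qd; have h1' : l < m.+1 by [].
by exists (Ordinal h1', Ordinal h2, Ordinal h3).
Qed.

Section Family.
Variables (cx : copy p) (dx : (arity cx).-tuple descriptor).
Let K2 := 5 * K + 3.
Let H := K2.*2.+1.
Hypothesis vdx : forall q, q \in dx -> valid_descriptor N K2 3 q.

Definition before_target (tau b i : nat) (c : copy p)
    (d : (arity c).-tuple descriptor) : bool :=
  [&& H <= i, i + H <= tau, selN N (blocks tau) (attach_cut K b i tau d) &
      precN N (blocks tau) (attach_cut K b i tau d) (attach_blocks tau K2 dx)].

(** On a word cut at [i], selection and ties are constant, and the difference of
    the two ranks is affine in [i] and [tau]. *)
Lemma before_target_slope b (c : copy p) (d : (arity c).-tuple descriptor) :
  b < 3 -> (forall q, q \in d -> valid_descriptor N K 4 q) ->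
  rational_slope (fun tau => count (fun i => before_target tau b i d) (iota 0 tau)).
Proof.
move=> b3 vd; pose e := map_tuple (widen K K2) d.
pose ex := map_tuple (cut_anchor b) dx.
have KK2 : K <= K2 by rewrite /K2; lia.
have ve q : q \in e -> valid_descriptor N K2 4 q.
  by move=> /mapP[q' /vd vq ->]; apply: valid_widen.
have vex q : q \in ex -> valid_descriptor N K2 4 q.
  by move=> /mapP[q' /vdx vq ->]; apply: valid_cut_anchor.
pose n0 : nat -> nat := fun _ => H.
pose s := selN N (segments 4 (cut_types b) n0) (attach (p := p) K2 n0 e).
pose x0 := chiN N (segments 4 (cut_types b) n0) (attach (p := p) K2 n0 e)
             (attach (p := p) K2 n0 ex).
have [r0 [r hr]] := rankN_affine (m := 4) tameN (cut_types b) ve.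
have [r0' [r' hr']] := rankN_affine (m := 4) tameN (cut_types b) vex.
pose X1 := (r b - r' b - (r b.+1 - r' b.+1))%R.
pose S := (\sum_(j < 4 | (j != b :> nat) && (j != b.+1 :> nat)) (r j - r' j))%R.
pose X2 := ((r b.+1 - r' b.+1) + S)%R.
have main tau i : H <= i -> i + H <= tau ->
    [/\ selN N (blocks tau) (attach_cut K b i tau d) = s &
     precN N (blocks tau) (attach_cut K b i tau d) (attach_blocks tau K2 dx) =
     (ltlex (r0 - r0' + X1 *+ i + X2 *+ tau) 0 ||
      (r0 - r0' + X1 *+ i + X2 *+ tau == 0) && x0)%R].
  move=> Hi iH; have it : i <= tau by lia.
  have lens_ok j : j < 4 -> K2.*2 < cut_lens b i tau j.
    by move=> _; apply: cut_lens_gt; lia.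
  have n0_ok j : j < 4 -> K2.*2 < n0 j by [].
  have -> : attach_cut K b i tau d = attach (p := p) K2 (cut_lens b i tau) e.
    congr existT; apply: val_inj; rewrite /= -map_comp.
    by apply: eq_map => q; rewrite /= locate_widen.
  have -> : attach_blocks tau K2 dx = attach (p := p) K2 (cut_lens b i tau) ex.
    congr existT; apply: val_inj; rewrite /= -map_comp.
    by apply/eq_in_map => q /vdx /and5P[q3 _ _ _ _]; rewrite /= locate_cut_anchor.
  rewrite -(segments_cut b3 it); split; first exact: selN_attach.
  rewrite /precN -/x0 (chiN_attach tameN (cut_types b) lens_ok n0_ok ve vex) -/x0.
  rewrite hr // hr' //.
  set u := (r0 + _)%R; set v := (r0' + _)%R.
  have -> : (r0 - r0' + X1 *+ i + X2 *+ tau = u - v)%R.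
    rewrite /u /v !cut_sum // !GRing.sumrMnl /X2 /X1 /S GRing.sumrB.
    have [m em] : exists m, tau = m + i by exists (tau - i); rewrite subnK.
    rewrite em addnK; move: (r b) (r b.+1) (r' b) (r' b.+1) => A B A' B'.
    move: (\sum_(_ < 4 | _) r _)%R (\sum_(_ < 4 | _) r' _)%R => C C'.
    rewrite !(GRing.mulrnDr, GRing.mulrnBl, GRing.mulrnDl).
    move: (A *+ i)%R (A' *+ i)%R (B *+ i)%R (B' *+ i)%R (B *+ m)%R (B' *+ m)%R
      (C *+ i)%R (C' *+ i)%R (C *+ m)%R (C' *+ m)%R => A1 A2 B1 B2 B3 B4 C1 C2 C3 C4.
    by apply/rowP => j; rewrite !mxE; ring.
  by rewrite -(ltlexD2r (- v)%R) GRing.subrr -GRing.subr_eq0.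
case s_true : s; last first.
  apply: (@rational_slope_close 0 0) rational_slope0 => tau _.
  rewrite (eq_count (a2 := pred0)) ?count_pred0 // => i; rewrite /before_target.
  by case: (leqP H i) => //= Hi; case: (leqP (i + H) tau) => //= iH;
    have [-> _] := main tau i Hi iH; rewrite s_true.
apply: (@rational_slope_close 0 0) (affine_lex_slope (r0 - r0')%R X1 X2 x0 H) => tau _.
rewrite !addn0; set A := count _ _; set B := count _ _; suff -> : A = B by [].
apply: eq_count => i; rewrite /before_target.
case: (leqP H i) => //= Hi; case: (leqP (i + H) tau) => //= iH.
by have [-> ->] := main tau i Hi iH; rewrite s_true.
Qed.

Let ltH_l i : H <= i -> K.*2 < i.
Proof. by rewrite /H /K2; lia. Qed.

Let ltH_r i tau : i + H <= tau -> i + K.*2 < tau.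
Proof. by rewrite /H /K2; lia. Qed.

Definition family : finType :=
  {c : copy p & ('I_3 * (arity c).-tuple (code 4 K))%type}.

Definition member (tau : nat) (f : family) (i : nat) : cell_atom p :=
  attach_cut K (tagged f).1 i tau (decodes (tagged f).2).

Definition counted (tau : nat) (f : family) (i : nat) : bool :=
  [&& all (valid_descriptor N K 4) (decodes (tagged f).2),
      centered K (tagged f).1 (decodes (tagged f).2) &
      before_target tau (tagged f).1 i (decodes (tagged f).2)].

Lemma counted_slope f :
  rational_slope (fun tau => count (counted tau f) (iota 0 tau)).
Proof.
case: f => c [b t].
case: (boolP (all (valid_descriptor N K 4) (decodes t) && centered K b (decodes t))).
  move=> /andP[/allP vt ct].
  apply: (@rational_slope_close 0 0) (before_target_slope (ltn_ord b) vt) => tau _.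
  rewrite !addn0 (eq_count (a2 := counted tau (existT _ c (b, t)))) // => i.
  by rewrite /counted /= ct (introT allP vt).
move=> h; apply: (@rational_slope_close 0 0) rational_slope0 => tau _.
rewrite (eq_count (a2 := pred0)) ?count_pred0 // => i.
by rewrite /counted /= andbA (negPf h).
Qed.

Lemma count_allpairs (A B C : Type) (h : A -> B -> C) (P : pred C) (s : seq A) (t : seq B) :
  count P (allpairs h s t) = \sum_(x <- s) count (fun y => P (h x y)) t.
Proof.
elim: s => [|x s IH]; first by rewrite big_nil.
by rewrite big_cons /= count_cat count_map IH.
Qed.

(** Atoms with a free cluster are enumerated without repetition by a family and
    the place of the cut, which reduces their count to that of each family; the
    other ones are bounded in number. *)
Lemma prefix_count_slope : exists g C, rational_slope g /\
  forall tau (x : atom p (word tau)), coords N x = attach_blocks tau K2 dx ->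
    #|[set y in selected p (word tau) | prec y x]| <= g tau + C /\
    g tau <= #|[set y in selected p (word tau) | prec y x]| + C.
Proof.
pose g tau := \sum_(f <- enum family) count (counted tau f) (iota 0 tau).
pose rest : finType := {c : copy p & (arity c).-tuple (code 3 (H + K))}.
exists g, #|rest|; split; first by apply: rational_slope_sum => f; apply: counted_slope.
move=> tau x ex; pose S := [set y in selected p (word tau) | prec y x].
pose s1 := [seq coords N y | y <- enum S].
pose dom := [seq fi <- allpairs pair (enum family) (iota 0 tau) | counted tau fi.1 fi.2].
pose s2 := [seq member tau fi.1 fi.2 | fi <- dom].
pose s3 := [seq attach_blocks tau (H + K) (decodes (tagged z)) | z <- enum rest].
have sz1 : size s1 = #|S| by rewrite size_map cardE.
have sz2 : size s2 = g tau by rewrite size_map size_filter count_allpairs.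
have sz3 : size s3 = #|rest| by rewrite size_map cardE.
have in_s1 (y : atom p (word tau)) : selN N (blocks tau) (coords N y) ->
    precN N (blocks tau) (coords N y) (attach_blocks tau K2 dx) -> coords N y \in s1.
  rewrite selN_coords -ex precN_coords => sy py.
  by apply: map_f; rewrite mem_enum inE sy.
have u1 : uniq s1 by rewrite map_inj_uniq ?enum_uniq //; exact: (@coords_inj p N).
have u2 : uniq s2.
  rewrite map_inj_in_uniq; last first.
    move=> [[c [b t]] i] [[c' [b' t']] i']; rewrite !mem_filter /counted /member /=.
    move=> /andP[/and3P[/allP vt ct /and4P[Hi iH _ _]] _].
    move=> /andP[/and3P[/allP vt' ct' /and4P[Hi' iH' _ _]] _] e.
    have ec : c = c' := congr1 tag e.
    subst c'; move/eqP: e; rewrite eq_Tagged => /eqP e.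
    have [eb ei /decodes_inj et] :=
      locates_cut_inj (ltn_ord b) (ltn_ord b') (ltH_l Hi) (ltH_r iH) (ltH_l Hi')
        (ltH_r iH') vt vt' ct ct' e.
    by rewrite ei et (val_inj eb).
  apply/filter_uniq/allpairs_uniq; rewrite ?enum_uniq ?iota_uniq //.
  by move=> [f i] [f' i'].
split.
  rewrite -/S -sz1 -sz2 -sz3 -size_cat; apply: uniq_leq_size => // _ /mapP[y yS ->].
  rewrite mem_enum inE in yS; have /andP[sy py] := yS.
  have KH : K.*2 < H by rewrite /H /K2; lia.
  rewrite mem_cat; apply/orP.
  have [near|[b [i [d [b3 Hi iH vd [ed cd]]]]]] :=
    selected_coords_shape tameN arityK linear_growth KH sy.
    right; have [d ed vd] := near_boundary_attach near.
    have [t et] := decodes_surj vd; apply/mapP.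
    exists (Tagged (fun c => (arity c).-tuple (code 3 (H + K))) t).
      by rewrite mem_enum.
    by rewrite /= et.
  left; have [t et] := decodes_surj vd; apply/mapP.
  pose f : family := Tagged (fun c => ('I_3 * (arity c).-tuple (code 4 K))%type)
                       (Ordinal b3, t).
  exists (f, i); last by rewrite /member /= et.
  have et' : [seq decode q | q <- t] = d :> seq _ by rewrite -et.
  rewrite mem_filter /counted /before_target /f /= et et' cd Hi iH -ed selN_coords sy -ex
    precN_coords py /= !andbT.
  apply/andP; split; first by apply/allP => q; apply: vd.
  by rewrite allpairs_f ?mem_enum // mem_iota; lia.
rewrite -/S -sz1 -sz2; apply: leq_trans (leq_addr _ _); apply: uniq_leq_size => //.
move=> _ /mapP[[[c [b t]] i] fi ->]; move: fi.
rewrite mem_filter /counted /member /= => /andP[/and3P[/allP vt ct /and4P[Hi iH sel pr]] _].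
have [y ey] : exists y : atom p (word tau), coords N y = attach_cut K b i tau (decodes t).
  exact: attach_cut_atom (ltn_ord b) (ltH_l Hi) (ltH_r iH) vt.
by rewrite -ey in sel pr *; apply: in_s1.
Qed.

End Family.
End Count.

(** * Dyck paths whose area and dinv have the largest possible sum *)

Section SlowSequences.
Variables (n l : nat) (f : nat -> nat).

Definition dinv_at (j : nat) : nat :=
  count (fun i => (f i == f j) || (f i == (f j).+1)) (iota 0 j).

Hypothesis f0 : f 0 = 0.
Hypothesis fS : forall j, j.+1 < n -> f j.+1 <= (f j).+1.

(** The sequence starts at 0 and rises by at most 1, so it takes every value below
    [f j] before [j]. *)
Lemma smaller_before j v : j < n -> v <= f j ->
  v <= count (fun i => f i < v) (iota 0 j).
Proof.
elim: j v => [|j IH] v jn vj; first by rewrite f0 in vj; lia.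
rewrite -addn1 iotaD count_cat add0n /= addn0.
case: (leqP v (f j)) => vfj; first by have := IH v (ltnW jn) vfj; lia.
have ev : v = (f j).+1 by have := fS jn; lia.
have := IH (f j) (ltnW jn) (leqnn _).
have : count (fun i => f i < f j) (iota 0 j) <= count (fun i => f i < v) (iota 0 j).
  by apply: sub_count => i /=; lia.
by move=> h1 h2; lia.
Qed.

Lemma add_dinv_at_le j : j < n -> f j + dinv_at j <= j.
Proof.
move=> jn; have := smaller_before jn (leqnn _); rewrite /dinv_at.
set P := fun i => f i < f j; set Q := fun i => _ || _ => h.
apply: leq_trans (_ : count P (iota 0 j) + count Q (iota 0 j) <= _); first by rewrite leq_add2r.
rewrite -count_predUI (_ : count (predI P Q) _ = 0) ?addn0.
  by rewrite -[X in _ <= X](size_iota 0 j) count_size.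
by apply/eqP; rewrite -leqn0 leqNgt -has_count; apply/hasPn => i _; rewrite /= /P /Q; lia.
Qed.

Hypothesis total : \sum_(j < n) (f j + dinv_at j) = \sum_(j < n) j.

(** The bounds of [add_dinv_at_le] sum up to the hypothesis [total]. *)
Lemma add_dinv_at_eq j : j < n -> f j + dinv_at j = j.
Proof.
move=> jn; have := leqif_sum (P := xpredT) (fun (i : 'I_n) _ =>
  leqif_eq (add_dinv_at_le (ltn_ord i))).
case=> _; rewrite total eqxx => /esym/forall_inP h.
by have /eqP := h (Ordinal jn) isT.
Qed.

Hypothesis l0 : 0 < l.
Hypothesis run : forall j, j < l -> f j = j.
Hypothesis fl : l < n -> f l < l.

(** At the first entry [l] after the run, no earlier entry is [l] or more, so
    [dinv_at] vanishes there and [add_dinv_at_eq] fails. *)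
Lemma after_run_le j : j < n -> f j < l.
Proof.
elim/ltn_ind: j => j IH jn; case: (ltngtP j l) => jl; last by rewrite jl in jn *; apply: fl.
  by rewrite run.
case: j IH jn jl => // j IH jn jl; rewrite ltnNge; apply/negP => hl.
have fj : f j.+1 = l by have := fS jn; have := IH j (ltnSn j) (ltnW jn); lia.
have := add_dinv_at_eq jn; rewrite /dinv_at fj (eq_in_count (a2 := pred0)).
  by rewrite count_pred0; lia.
by move=> i; rewrite mem_iota add0n => /andP[_ ij]; have := IH i ij (ltn_trans ij jn); rewrite /=; lia.
Qed.

(** Among the entries of the run at most two are counted by [dinv_at j]; for small
    [f j] this is too few for [add_dinv_at_eq]. *)
Lemma after_run_ge j : l <= j -> j < n -> l <= (f j).+2.
Proof.
move=> lj jn; rewrite leqNgt; apply/negP => hl.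
have ej : iota 0 j = iota 0 l ++ iota l (j - l) by rewrite -{1}(subnKC lj) iotaD.
have := add_dinv_at_eq jn; rewrite /dinv_at ej count_cat; set Q := fun i => _ || _.
have := count_size Q (iota l (j - l)); rewrite size_iota.
have : count Q (iota 0 l) <= 2; last by lia.
have -> : count Q (iota 0 l) = count (fun i => (i == f j) || (i == (f j).+1)) (iota 0 l).
  apply: eq_in_count => i; rewrite mem_iota add0n => /andP[_ il].
  by rewrite /Q run //.
have := count_predUI (pred1 (f j)) (pred1 (f j).+1) (iota 0 l).
rewrite !count_uniq_mem ?iota_uniq // => h.
apply: leq_trans (_ : count (predU (pred1 (f j)) (pred1 (f j).+1)) (iota 0 l) <= _).
  by rewrite leq_eqVlt; apply/orP; left; apply/eqP; apply: eq_count.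
by move: h; case: (_ \in _); case: (_ \in _) => /=; lia.
Qed.

Hypothesis ln : l <= n.

Lemma sum_after_run :
  2 * (\sum_(j < n) f j) <= l * l.-1 + 2 * (n - l) * l.-1 /\
  l * l.-1 + 2 * (n - l) * l.-1 <= 2 * (\sum_(j < n) f j) + 2 * (n - l).
Proof.
have run_sum k : k <= l -> 2 * \sum_(0 <= j < k) f j = k * k.-1.
  elim: k => [|k IH] kl; first by rewrite big_geq.
  by rewrite big_nat_recr //= mulnDr IH 1?ltnW // run //; case: (k) => //= k'; lia.
have -> : \sum_(j < n) f j = \sum_(0 <= j < l) f j + \sum_(l <= j < n) f j.
  by rewrite -(big_mkord xpredT f) (big_cat_nat (n := l)).
rewrite mulnDr run_sum //.
have h1 : \sum_(l <= j < n) f j <= (n - l) * l.-1.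
  rewrite -sum_nat_const_nat big_nat_cond [X in _ <= X]big_nat_cond.
  by apply: leq_sum => j /andP[/andP[_ jn] _]; have := after_run_le jn; lia.
have h2 : (n - l) * l.-1 <= \sum_(l <= j < n) f j + (n - l).
  rewrite -[X in _ + X]muln1 -!sum_nat_const_nat -big_split big_nat_cond.
  rewrite [X in _ <= X]big_nat_cond.
  by apply: leq_sum => j /andP[/andP[lj jn] _] /=; have := after_run_ge lj jn; lia.
by split; lia.
Qed.

End SlowSequences.

(** ** From words to sequences *)

Section Areas.
Import Order.TTheory GRing.Theory Num.Theory.
Local Open Scope ring_scope.

(** [h] is the height reached before the word [w]. *)
Fixpoint areas_from (h : int) (w : seq step) : seq int :=
  match w with
  | [::] => [::]
  | U :: w' => h :: areas_from (h + 1) w'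
  | D :: w' => areas_from (h - 1) w'
  end.

Lemma area_seqE w : area_seq w = areas_from 0 w.
Proof.
suff H u : [seq height (u ++ w) i | i <- iota (size u) (size w) & nth D (u ++ w) i == U]
    = areas_from (height u (size u)) w by have := H [::].
elim: w u => [|x w IH] u //=.
have hS : height (rcons u x) (size u).+1 = height u (size u) + (if x is U then 1 else -1).
  rewrite -(size_rcons u x) /height !take_size -cats1 !count_cat.
  by case: (x) => /=; lia.
have hu : height (u ++ x :: w) (size u) = height u (size u).
  by rewrite /height take_size_cat // take_size.
have := IH (rcons u x); rewrite size_rcons cat_rcons hS => {}IH.
rewrite nth_cat ltnn subnn /=; case: (x) IH hu => /= IH hu.
  by rewrite hu IH.
by rewrite IH.
Qed.

Lemma size_areas_from h w : size (areas_from h w) = count_mem U w.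
Proof. by elim: w h => //= -[] w IH h /=; rewrite IH. Qed.

Lemma areas_from_path h w : path (fun x y => y <= x + 1) (h - 1) (areas_from h w).
Proof.
elim: w h => //= -[] w IH h /=; first by rewrite subrK lexx; have := IH (h + 1); rewrite addrK.
have := IH (h - 1); case: areas_from => //= y s /andP[h1 ->]; rewrite andbT; lia.
Qed.

Lemma areas_from_run h k w : areas_from h (nseq k U ++ D :: w) =
  [seq h + j%:Z | j <- iota 0 k] ++ areas_from (h + k%:Z - 1) w.
Proof.
elim: k h => [|k IH] h /=; first by rewrite addr0.
rewrite IH addr0; congr cons; congr (_ ++ areas_from _ _); last by lia.
rewrite -[1%N]addn0 iotaDl -map_comp; apply: eq_map => j /=; lia.
Qed.

Lemma count_iota (P : pred nat) k : count P (iota 0 k) = (\sum_(i < k) P i)%N.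
Proof.
elim: k => [|k IH]; first by rewrite big_ord0.
by rewrite -addn1 iotaD count_cat IH add0n addn1 big_ord_recr /= addn0.
Qed.

Lemma dinvE w : dinv w =
  (\sum_(j < size (area_seq w)) dinv_at (fun i => absz ((area_seq w)`_i)%R) j)%N \/
  exists2 i, (i < size (area_seq w))%N & (area_seq w)`_i < 0.
Proof.
set a := area_seq w.
case: (boolP (all (fun x => 0 <= x) a)) => [/all_nthP a0|]; last first.
  by move=> /allPn[x /(nthP 0)[i ia <-]]; rewrite -ltNge; right; exists i.
left; rewrite /dinv -/a -sum1_card.
under eq_bigl => ij do rewrite inE.
rewrite -(pair_big_dep xpredT (fun i j : 'I_(size a) => (i < j)%N &&
  (a`_i - a`_j \in [:: 0; 1])) (fun _ _ => 1%N)) /=.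
rewrite (exchange_big_dep xpredT) //=; apply: eq_bigr => j _.
rewrite /dinv_at count_iota (big_ord_widen (size a) (fun i => nat_of_bool
  ((absz a`_i == absz a`_j) || (absz a`_i == (absz a`_j).+1))) (ltnW (ltn_ord j))).
rewrite big_mkcond [RHS]big_mkcond; apply: eq_bigr => i _.
have hi : (0 : int) <= a`_i by exact: (a0 0 i (ltn_ord i)).
have hj : (0 : int) <= a`_j by exact: (a0 0 j (ltn_ord j)).
rewrite !inE.
case: ltnP => //= _; rewrite (_ : (_ || _) = ((absz a`_i == absz a`_j) || (absz a`_i == (absz a`_j).+1))).
  by case: (_ || _).
move: (a`_i) (a`_j) hi hj => x y hx hy.
by apply/idP/idP; lia.
Qed.

Lemma areas_ge0 n P i : dyck n P -> 0 <= (area_seq P)`_i.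
Proof.
move=> [_ _ _ pre]; case: (ltnP i (size (area_seq P))) => hi; last by rewrite nth_default.
have /mapP[j _ ->] := mem_nth 0 hi.
by rewrite /height subr_ge0 lez_nat.
Qed.

Definition area_at (P : seq step) (i : nat) : nat := `|((area_seq P)`_i)%R|%N.

Lemma area_atE n P i : dyck n P -> (area_at P i)%:Z = (area_seq P)`_i.
Proof. by move=> dP; rewrite /area_at gez0_abs // (areas_ge0 _ dP). Qed.

Lemma size_area_seq n P : dyck n P -> size (area_seq P) = n.
Proof. by move=> [_ cU _ _]; rewrite area_seqE size_areas_from. Qed.

Lemma areaE n P : dyck n P -> area P = (\sum_(j < n) area_at P j)%N%:Z.
Proof.
move=> dP; rewrite /area (big_nth 0) big_mkord (size_area_seq dP).
rewrite (big_morph Posz PoszD (erefl _)); apply: eq_bigr => j _.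
by rewrite (area_atE _ dP).
Qed.

Lemma dyck_dinvE n P : dyck n P -> dinv P = (\sum_(j < n) dinv_at (area_at P) j)%N.
Proof.
move=> dP; have [->|[i _]] := dinvE P; first by rewrite (size_area_seq dP).
by rewrite ltNge (areas_ge0 _ dP).
Qed.

Lemma area_at_path n P i : dyck n P -> (i < n)%N ->
  (area_at P i <= if i is i'.+1 then (area_at P i').+1 else 0)%N.
Proof.
move=> dP iN; have := areas_from_path 0 P; rewrite -area_seqE => /(pathP 0) h.
have := h i; rewrite (size_area_seq dP) => /(_ iN).
by case: i iN {h} => [|i] iN /=; rewrite -?(area_atE _ dP); lia.
Qed.

Lemma dyck_run n Q : dyck n Q -> (0 < n)%N ->
  exists w, [/\ Q = nseq (index D Q) U ++ D :: w, (0 < index D Q)%N & (index D Q <= n)%N].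
Proof.
move=> [sQ cU cD pre] n0; have DQ : D \in Q by rewrite -has_pred1 has_count cD.
have iQ : (index D Q < size Q)%N by rewrite index_mem.
have eQ : Q = take (index D Q) Q ++ D :: drop (index D Q).+1 Q.
  by rewrite -{2}(nth_index U DQ) -drop_nth // cat_take_drop.
have run : take (index D Q) Q = nseq (index D Q) U.
  by elim: (Q) => //= -[] s IH //=; rewrite IH.
exists (drop (index D Q).+1 Q); split; first by rewrite -run.
  case: (Q) (pre 1%N) sQ => [|[] w] //=; first by lia.
  by rewrite take0.
by rewrite -cU {2}eQ count_cat run count_nseq /= mul1n leq_addr.
Qed.

Lemma double_sum_ord n : (2 * (\sum_(j < n) j) = n * n.-1)%N.
Proof.
elim: n => [|n IH]; first by rewrite big_ord0.
by rewrite big_ord_recr /= mulnDr IH; case: n {IH} => //= n; lia.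
Qed.

Lemma top_degree_run n Q A B : dyck n Q -> (0 < n)%N -> area Q = A%:Z -> dinv Q = B ->
  (2 * (A + B) = n * n.-1)%N ->
  let l := index D Q in
  [/\ (0 < l <= n)%N, (2 * A <= l * l.-1 + 2 * (n - l) * l.-1)%N &
     (l * l.-1 + 2 * (n - l) * l.-1 <= 2 * A + 2 * (n - l))%N].
Proof.
move=> dQ n0 eA eB eAB; have [w [eQ l0 ln]] := dyck_run dQ n0.
set l := index D Q in eQ l0 ln *.
have fS j : (j.+1 < n)%N -> (area_at Q j.+1 <= (area_at Q j).+1)%N.
  exact: (area_at_path dQ).
have f0 : area_at Q 0 = 0%N by have := area_at_path dQ n0; lia.
have areas : area_seq Q = [seq j%:Z | j <- iota 0 l] ++ areas_from (l%:Z - 1) w.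
  by rewrite area_seqE {1}eQ areas_from_run add0r; congr (_ ++ _).
have run j : (j < l)%N -> area_at Q j = j.
  move=> jl; rewrite /area_at areas nth_cat size_map size_iota jl.
  by rewrite (nth_map 0%N) ?size_iota // nth_iota.
have fl : (l < n)%N -> (area_at Q l < l)%N.
  move=> ln'; have := size_area_seq dQ; have := area_atE l dQ.
  rewrite areas size_cat size_map size_iota nth_cat size_map size_iota ltnn subnn.
  have := areas_from_path (l%:Z - 1) w; case: areas_from => [|y s] /=.
    by lia.
  by case/andP => h _ e _; lia.
have eS : (\sum_(j < n) area_at Q j = A)%N.
  by apply/eqP; rewrite -eqz_nat -(areaE dQ) eA.
have sumsum : (\sum_(j < n) (area_at Q j + dinv_at (area_at Q) j) = \sum_(j < n) j)%N.
  apply/eqP; rewrite big_split /= -(dyck_dinvE dQ) eB eS.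
  by rewrite -(eqn_pmul2l (m := 2)) // eAB double_sum_ord.
have [h1 h2] := sum_after_run f0 fS sumsum l0 run fl ln.
by rewrite eS in h1 h2; split; rewrite ?l0.
Qed.

End Areas.

(** ** The input paths *)

Definition trapezoid (k m : nat) : seq step :=
  nseq k U ++ flatten (nseq m [:: U; D]) ++ nseq k D.

Lemma count_flatten_nseq (T : Type) (P : pred T) m (s : seq T) :
  count P (flatten (nseq m s)) = m * count P s.
Proof. by elim: m => //= m IH; rewrite count_cat IH mulSn. Qed.

(** The path [w] stays nonnegative when it starts at height [h]. *)
Definition above (h : nat) (w : seq step) : Prop :=
  forall k, count_mem D (take k w) <= h + count_mem U (take k w).

Lemma above_cat h h' (w1 w2 : seq step) : h' + count_mem D w1 = h + count_mem U w1 ->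
  above h w1 -> above h' w2 -> above h (w1 ++ w2).
Proof.
move=> e a1 a2 k; rewrite take_cat; case: ltnP => _; first exact: a1.
rewrite !count_cat; have := a2 (k - size w1). lia.
Qed.

Lemma dyck_trapezoid k m : dyck (k + m) (trapezoid k m).
Proof.
have cU : count_mem U (trapezoid k m) = k + m.
  by rewrite /trapezoid !count_cat count_flatten_nseq !count_nseq /=; lia.
have cD : count_mem D (trapezoid k m) = k + m.
  by rewrite /trapezoid !count_cat count_flatten_nseq !count_nseq /=; lia.
split=> //.
  have <- := count_predC (pred1 U) (trapezoid k m).
  by rewrite cU (eq_count (a2 := pred1 D)) ?cD ?addnn // => -[].
suff : above 0 (trapezoid k m) by [].
apply: (@above_cat 0 k).
- by rewrite !count_nseq /=; lia.
- move=> j; rewrite (_ : count_mem D _ = 0) //; apply/eqP; rewrite -leqn0 leqNgt -has_count.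
  by apply/hasPn => x /mem_take; rewrite mem_nseq => /andP[_ /eqP->].
apply: (@above_cat k k).
- by rewrite !count_flatten_nseq /=; lia.
- elim: m {cU cD} => [|m IH] //; rewrite -cat1s /= -/(flatten _).
  apply: (@above_cat k k [:: U; D]) => //; case=> [|[|[|j]]] //=; lia.
move=> j; have := count_size (pred1 D) (take j (nseq k D)).
by rewrite size_take_min size_nseq; lia.
Qed.

Lemma area_at_trapezoid k m i : i < k + m -> area_at (trapezoid k m) i = minn i k.
Proof.
move=> hi; suff : ((area_seq (trapezoid k m))`_i = (minn i k)%:Z)%R by rewrite /area_at => ->.
have up h j w : areas_from h (nseq j U ++ w) =
    ([seq h + l%:Z | l <- iota 0 j] ++ areas_from (h + j%:Z) w)%R.
  elim: j h => [|j IH] h /=; first by rewrite GRing.addr0.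
  rewrite IH GRing.addr0; congr cons; congr (_ ++ areas_from _ _); last by lia.
  rewrite -[1]addn0 iotaDl -map_comp; apply: eq_map => l /=; lia.
have zigzag h j w : areas_from h (flatten (nseq j [:: U; D]) ++ w) = nseq j h ++ areas_from h w.
  by elim: j => //= j IH; rewrite GRing.addrK IH.
rewrite area_seqE /trapezoid up zigzag nth_cat size_map size_iota.
case: ltnP => ik.
  by rewrite (nth_map 0) ?size_iota // nth_iota // GRing.add0r add0n (minn_idPl (ltnW ik)).
rewrite nth_cat size_nseq nth_nseq ifT; last by lia.
by rewrite ifT ?GRing.add0r ?(minn_idPr ik) //; lia.
Qed.

Lemma dinv_at_trapezoid k m j : j < k + m -> dinv_at (area_at (trapezoid k m)) j = j - k.
Proof.
move=> hj; rewrite /dinv_at (eq_in_count (a2 := fun i => k <= i)).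
  elim: (j) => [|l IH]; first by rewrite sub0n.
  by rewrite -addn1 iotaD count_cat IH /= add0n; case: leqP; lia.
by move=> i; rewrite mem_iota add0n => /andP[_ ij]; rewrite !area_at_trapezoid //; lia.
Qed.

Lemma area_trapezoid k m : exists2 A : nat, area (trapezoid k m) = A%:Z%R &
  2 * A = k * k.-1 + 2 * (k * m).
Proof.
exists (\sum_(j < k + m) area_at (trapezoid k m) j); first exact: (areaE (dyck_trapezoid k m)).
rewrite (eq_bigr (fun j : 'I_(k + m) => minn j k)); last by move=> j _; rewrite area_at_trapezoid.
elim: m => [|m IH]; last by rewrite addnS big_ord_recr /= mulnDr IH; nia.
rewrite addn0 (eq_bigr (fun j : 'I_k => j : nat)); first by rewrite double_sum_ord; lia.
by move=> j _; apply/minn_idPl/ltnW.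
Qed.

Lemma dinv_trapezoid k m : 2 * dinv (trapezoid k m) = m * m.-1.
Proof.
rewrite (dyck_dinvE (dyck_trapezoid k m)).
rewrite (eq_bigr (fun j : 'I_(k + m) => j - k)); last by move=> j _; rewrite dinv_at_trapezoid.
elim: m => [|m IH].
  by rewrite addn0 big1 // => j _; apply/eqP; rewrite subn_eq0 ltnW.
by rewrite addnS big_ord_recr /= mulnDr IH; case: m {IH} => [|m] /=; [lia|nia].
Qed.

(** * The first descent of the output *)

Section Output.
Variables (p : wrp_pres step step) (w : seq step).
Notation A := (selected p w).

Lemma prec_irr : {in A, irreflexive (@prec _ _ p w)}.
Proof.
by move=> x xA; rewrite /prec ltlex_irr eqxx (chi_irreflexive (p := wrp_polyreg p) xA).
Qed.

Lemma prec_trans : {in A & &, transitive (@prec _ _ p w)}.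
Proof.
move=> y x z yA xA zA; rewrite /prec.
move=> /orP[xy|/andP[/eqP-> cxy]] /orP[yz|/andP[/eqP eyz cyz]].
- by rewrite (ltlex_trans xy yz).
- by rewrite -eyz xy.
- by rewrite yz.
- by rewrite eyz eqxx (chi_transitive (p := wrp_polyreg p) yA xA zA cxy cyz) orbT.
Qed.

Lemma prec_total : {in A &, forall x y, x != y -> prec x y || prec y x}.
Proof.
move=> x y xA yA nxy; rewrite /prec; case: (eqVneq (atom_rank x) (atom_rank y)) => [->|ne].
  by rewrite ltlex_irr /= ?eqxx (chi_total (p := wrp_polyreg p)).
by have := ltlex_total ne; case/orP=> ->; rewrite ?orbT.
Qed.

Lemma preceq_total : {in A &, total (@preceq _ _ p w)}.
Proof.
move=> x y xA yA; rewrite /preceq [y == x]eq_sym; case: (eqVneq x y) => //= nxy.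
exact: prec_total.
Qed.

Lemma preceq_trans : {in A & &, transitive (@preceq _ _ p w)}.
Proof.
move=> y x z yA xA zA; rewrite /preceq => /predU1P[->//|xy] /predU1P[<-|yz].
  by rewrite xy orbT.
by rewrite (prec_trans yA xA zA xy yz) orbT.
Qed.

Lemma label_selected (x : atom p w) g : x \in A -> (label x == Some g) = has_label x g.
Proof.
move=> xA; have [h [hh uh]] := label_unique (p := wrp_polyreg p) xA.
rewrite /label; case: pickP => [g' hg'|/(_ h)]; last by rewrite hh.
rewrite -(uh _ hg'); apply/eqP/idP => [[<-]//|hg]; congr Some; exact: uh.
Qed.

Lemma label_some (x : atom p w) : x \in A -> label x != None.
Proof.
move=> xA; have [h [hh _]] := label_unique (p := wrp_polyreg p) xA.
by have := label_selected h xA; rewrite hh => /eqP->.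
Qed.

Lemma index_pmap (T : Type) (B : eqType) (f : T -> option B) (b : B) (s : seq T) :
  all (fun x => f x != None) s ->
  index b (pmap f s) = find (fun x => f x == Some b) s.
Proof.
elim: s => //= x s IH /andP[fx /IH {}IH]; case: (f x) fx => //= c _.
by rewrite IH; case: (c =P b) => [->|ne]; rewrite ?eqxx //; case: eqP => // -[].
Qed.

Lemma size_pmap_all (T B : Type) (f : T -> option B) (s : seq T) :
  all (fun x => isSome (f x)) s -> size (pmap f s) = size s.
Proof. by elim: s => //= x s IH /andP[]; case: (f x) => //= y _ /IH->. Qed.

Variable Q : seq step.
Hypothesis wQ : wrp_map p w = Some Q.

Let s := sort (@preceq _ _ p w) (enum A).

Let QE : Q = pmap (@label _ _ p w) s.
Proof. by move: wQ; rewrite /wrp_map; case: ifP => // _ [<-]. Qed.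

Let s_mem x : (x \in s) = (x \in A).
Proof. by rewrite mem_sort mem_enum. Qed.

Let s_label : all (fun x => label x != None) s.
Proof. by apply/allP => x; rewrite s_mem; apply: label_some. Qed.

Lemma size_output : size Q = #|A|.
Proof.
rewrite QE size_pmap_all ?size_sort ?cardE //.
by apply: sub_all s_label => x; case: (label x).
Qed.

(** In the sorted list of atoms, the ones before the first atom labelled D are
    exactly those that precede it. *)
Lemma first_descent : D \in Q ->
  exists x, [/\ x \in A, has_label x D,
    forall y, y \in A -> has_label y D -> ~~ prec y x &
    index D Q = #|[set y in A | prec y x]|].
Proof.
rewrite -index_mem size_output QE index_pmap //; set k := find _ _ => kA.
have szs : size s = #|A| by rewrite size_sort cardE.
have us : uniq s by rewrite sort_uniq enum_uniq.
have [x0 _] : exists x0, x0 \in A by apply/card_gt0P; lia.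
have nthA i : i < #|A| -> nth x0 s i \in A by rewrite -s_mem => ?; rewrite mem_nth ?szs.
pose x := nth x0 s k; have xA : x \in A by apply: nthA.
have srt : sorted (@preceq _ _ p w) s.
  apply: (sort_sorted_in preceq_total); apply/allP => y; by rewrite mem_enum.
have allA : all [in A] s by apply/allP => y; rewrite s_mem.
have lt i j : i < j -> j < #|A| -> prec (nth x0 s i) (nth x0 s j).
  move=> ij jA; have iA := ltn_trans ij jA.
  have := sorted_ltn_nth_in preceq_trans x0 allA srt.
  move=> /(_ i j); rewrite !inE szs => /(_ iA jA ij).
  by rewrite /preceq nth_uniq ?szs // ltn_eqF.
have ge i : k <= i -> i < #|A| -> ~~ prec (nth x0 s i) x.
  rewrite leq_eqVlt => /predU1P[<-|ki] iA; first by rewrite prec_irr.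
  apply/negP => h; have := prec_trans (nthA _ iA) xA xA (lt _ _ ki iA) h.
  by rewrite prec_irr.
exists x; split=> //.
- have := @nth_find _ x0 (fun x => label x == Some D) s.
  by rewrite label_selected // has_find szs; apply.
- move=> y yA ly; have ys : y \in s by rewrite s_mem.
  rewrite -(nth_index x0 ys); apply: ge; last by rewrite -szs index_mem.
  rewrite leqNgt; apply/negP => /(before_find x0); rewrite nth_index //.
  by rewrite label_selected // ly.
- rewrite cardE -[LHS]addn0.
  have -> : size (enum [set y in A | prec y x]) = count (fun y => prec y x) s.
    rewrite -size_filter; apply: perm_size; apply: uniq_perm.
    + exact: enum_uniq.
    + by rewrite filter_uniq.
    + by move=> y; rewrite mem_enum inE mem_filter s_mem andbC.
  rewrite -(cat_take_drop k s) count_cat; congr addn.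
    have st : size (take k s) = k by rewrite size_takel // szs ltnW.
    transitivity (size (take k s)) => //; apply/esym/eqP; rewrite -all_count.
    apply/(all_nthP x0) => i; rewrite st => ik.
    by rewrite nth_take //; apply: lt.
  apply/esym/eqP; rewrite -leqn0 leqNgt -has_count; apply/(has_nthP x0) => -[i].
  rewrite size_drop szs nth_drop => ik; apply/negP; apply: ge; lia.
Qed.

End Output.

(** * The irrational slope *)

Section IrrationalSlope.
Import Order.TTheory GRing.Theory Num.Theory.

Lemma sqr_neq_8sqr a b : 0 < b -> a * a <> 8 * (b * b).
Proof.
move=> b0 e; have a0 : 0 < a by case: a e => //; nia.
have := congr1 (logn 2) e; rewrite !lognM // ?muln_gt0 ?b0 //.
by rewrite (_ : logn 2 8 = 3) //; lia.
Qed.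

(** The two bounds on [u * u.-1], with [u = P * tau], say that
    [6ul - l^2 - u^2] is of order [u].  If [l] were close to [z / q * tau], then
    [Z = 6Pqz - z^2 - q^2 P^2] would have to vanish, that is,
    [(z - 3Pq)^2 = 8 (Pq)^2]. *)
Lemma irrational_slope q z B P : 0 < q -> 0 < P ->
  exists n1, forall tau l, n1 <= tau ->
    q * l <= z * tau + B -> z * tau <= q * l + B ->
    0 < l <= 3 * (P * tau) ->
    (P * tau) * (P * tau).-1 <= l * l.-1 + 2 * (3 * (P * tau) - l) * l.-1 ->
    l * l.-1 + 2 * (3 * (P * tau) - l) * l.-1 <=
      (P * tau) * (P * tau).-1 + 2 * (3 * (P * tau) - l) -> False.
Proof.
move=> q0 P0.
(* [M * tau] will bound [Z * tau ^ 2]. *)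
pose M := 11 * q * q * P + (6 * P * q * B + 2 * z * B + B * B).
exists M.+1 => tau l tauM h1 h2 /andP[l0 l3] h3 h4.
have [e [el eB eB']] : exists e : int, [/\ (q%:Z * l%:Z = z%:Z * tau%:Z + e)%R,
    (e <= B%:Z)%R & (- B%:Z <= e)%R].
  by exists (q%:Z * l%:Z - z%:Z * tau%:Z)%R; split; lia.
pose u := P * tau.
pose E : int := (6 * u%:Z * l%:Z - l%:Z * l%:Z - u%:Z * u%:Z)%R.
have [u' eu] : exists u', u = u'.+1 by exists u.-1; rewrite prednK // /u muln_gt0 P0; lia.
have [l' el'] : exists l', l = l'.+1 by exists l.-1; lia.
have [r er] : exists r, 3 * u = l + r by exists (3 * u - l); rewrite subnKC.
rewrite -/u er addKn eu el' /= in h3 h4.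
pose W : int := (l'.+1%:Z * l'%:Z + 2 * r%:Z * l'%:Z - u'.+1%:Z * u'%:Z)%R.
have W0 : (0 <= W)%R by rewrite /W; lia.
have W1 : (W <= 2 * r%:Z)%R by rewrite /W; lia.
have er' : (r%:Z = 3 * u'%:Z + 2 - l'%:Z)%R by lia.
have EW : (E = W + 5 * u'%:Z - l'%:Z + 4)%R.
  by rewrite /E /W eu el' er' -(addn1 u') -(addn1 l') !PoszD; ring.
have E0 : (0 <= E)%R by rewrite EW; lia.
have E1 : (E <= 11 * u%:Z)%R by rewrite EW eu; lia.
pose Z : int := (6 * P%:Z * q%:Z * z%:Z - z%:Z * z%:Z - q%:Z * q%:Z * P%:Z * P%:Z)%R.
pose R : int := (6 * P%:Z * q%:Z * tau%:Z * e - 2 * z%:Z * tau%:Z * e - e * e)%R.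
have ZR : (Z * (tau%:Z * tau%:Z) = q%:Z * q%:Z * E - R)%R.
  have -> : (q%:Z * q%:Z * E = 6 * u%:Z * q%:Z * (q%:Z * l%:Z) - (q%:Z * l%:Z) * (q%:Z * l%:Z)
     - q%:Z * q%:Z * u%:Z * u%:Z)%R by rewrite /E; ring.
  by rewrite el /R /Z /u PoszM; ring.
have bnd (c : nat) : (- (c%:Z * B%:Z) <= c%:Z * e <= c%:Z * B%:Z)%R.
  by rewrite -mulrN !ler_wpM2l.
have R1 : (- ((6 * P * q * B + 2 * z * B + B * B) * tau)%N%:Z <= R <=
    ((6 * P * q * B + 2 * z * B + B * B) * tau)%N%:Z)%R.
  have /andP[b1 b2] := bnd (6 * P * q * tau); have /andP[b3 b4] := bnd (2 * z * tau).
  have t1 : B * B <= B * B * tau by rewrite leq_pmulr //; lia.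
  have b5 : (0 <= e * e)%R by rewrite -expr2 sqr_ge0.
  have b6 : (0 <= (B%:Z - e) * (B%:Z + e))%R by rewrite mulr_ge0; lia.
  have {b6} b6 : (e * e <= B%:Z * B%:Z)%R.
    by rewrite -subr_ge0 (_ : (_ - _ = (B%:Z - e) * (B%:Z + e))%R) //; ring.
  have -> : R = ((6 * P * q * tau)%N%:Z * e - (2 * z * tau)%N%:Z * e - e * e)%R.
    by rewrite /R !PoszM.
  by lia.
have Z0 : (Z = 0)%R.
  have E2 : (0 <= q%:Z * q%:Z * E <= (11 * q * q * P * tau)%N%:Z)%R.
    have -> : ((11 * q * q * P * tau)%N%:Z = q%:Z * q%:Z * (11 * u%:Z))%R.
      by rewrite /u !PoszM; ring.
    by apply/andP; split; [rewrite mulr_ge0 // mulr_ge0|rewrite ler_wpM2l // mulr_ge0].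
  have Zb : (- (M * tau)%N%:Z <= Z * (tau%:Z * tau%:Z) <= (M * tau)%N%:Z)%R.
    by rewrite ZR /M; lia.
  have tt : (M * tau < tau * tau)%N by rewrite ltn_pmul2r //; lia.
  have tt0 : (0 <= tau%:Z * tau%:Z)%R by rewrite mulr_ge0.
  case: (ltrgtP Z 0%R) => // hZ; exfalso.
    have : (1 * (tau%:Z * tau%:Z) <= - Z * (tau%:Z * tau%:Z))%R by rewrite ler_wpM2r //; lia.
    by rewrite mulNr; lia.
  have : (1 * (tau%:Z * tau%:Z) <= Z * (tau%:Z * tau%:Z))%R by rewrite ler_wpM2r //; lia.
  by lia.
apply: (@sqr_neq_8sqr `|(z%:Z - 3 * P%:Z * q%:Z)%R|%N (P * q)); first by rewrite muln_gt0 P0.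
apply/eqP; rewrite -eqz_nat !PoszM abszE -expr2 real_normK ?num_real //.
apply/eqP; move: Z0; rewrite /Z; nia.
Qed.

End IrrationalSlope.

(** * Exchanging area and dinv *)

Lemma flatten_nseq_flatten (T : Type) m k (s : seq T) :
  flatten (nseq m (flatten (nseq k s))) = flatten (nseq (m * k) s).
Proof. by elim: m => //= m ->; rewrite mulSn nseqD flatten_cat. Qed.

Lemma flatten_nseq_pair (T : Type) m (x : T) :
  flatten (nseq m [:: x; x]) = nseq (2 * m) x.
Proof. by elim: m => // m IH; rewrite mulnS /= IH. Qed.

Lemma cells_blocks N tau :
  cells N (blocks tau) = trapezoid (2 * (N`! * tau)) (N`! * tau).
Proof.
have cell_copies b : cells N (nseq tau b) = flatten (nseq (N`! * tau) (pattern b)).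
  by rewrite /cells map_nseq /cell flatten_nseq_flatten mulnC.
rewrite /blocks /segments /= cats0 !cells_cat !cell_copies /trapezoid.
by rewrite !flatten_nseq_pair.
Qed.

Section Contradiction.
Variable p : wrp_pres step step.
Hypothesis swap : forall (n : nat) (P : seq step), dyck n P ->
  exists Q : seq step,
    [/\ wrp_map p P = Some Q, dyck n Q, area Q = Posz (dinv P) & Posz (dinv Q) = area P].

Lemma swap_contradiction : False.
Proof.
have [N tameN] := tame_exists p.
pose K := (\max_(c : copy p) arity c).+1; pose u tau := N`! * tau.
have arityK (c : copy p) : arity c < K by rewrite ltnS leq_bigmax.
have out tau : exists Q, [/\ wrp_map p (cells N (blocks tau)) = Some Q,
    dyck (3 * u tau) Q, area Q = Posz (dinv (cells N (blocks tau))) &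
    Posz (dinv Q) = area (cells N (blocks tau))].
  have := swap (dyck_trapezoid (2 * u tau) (u tau)).
  by rewrite -cells_blocks (_ : 2 * u tau + u tau = 3 * u tau) //; lia.
have growth tau : #|selected p (cells N (blocks tau))| <= 6 * N`! * tau.
  have [Q [eQ [szQ _ _ _] _ _]] := out tau.
  by rewrite -(size_output eQ) szQ /u; lia.
pose K2 := 5 * K + 3.
pose target : finType := {c : copy p & (arity c).-tuple (code N 3 K2)}.
have [n1 hn1] : exists n1, forall tau, n1 <= tau -> forall z : target,
    (forall q, q \in decodes (tagged z) -> valid_descriptor N K2 3 q) ->
    forall x : atom p (cells N (blocks tau)),
    coords N x = attach_blocks tau K2 (decodes (tagged z)) ->
    let l := #|[set y in selected p (cells N (blocks tau)) | prec y x]| in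
    0 < l <= 3 * u tau ->
    u tau * (u tau).-1 <= l * l.-1 + 2 * (3 * u tau - l) * l.-1 ->
    l * l.-1 + 2 * (3 * u tau - l) * l.-1 <= u tau * (u tau).-1 + 2 * (3 * u tau - l) -> False.
  apply: fin_bound => z.
  have [/allP vz|nvz] := boolP (all (valid_descriptor N K2 3) (decodes (tagged z)));
    last by exists 0 => tau _ /allP; rewrite (negPf nvz).
  have [g [C [[q [r [B [n0 [q0 hg]]]]] hC]]] := prefix_count_slope tameN arityK growth vz.
  have [n1 hn1] := irrational_slope r (B + q * C) q0 (fact_gt0 N).
  exists (n0 + n1) => tau htau _ x ex l.
  have [g1 g2] := hg tau ltac:(lia); have [c1 c2] := hC tau x ex.
  rewrite -/l in c1 c2.
  have d1 : q * l <= q * (g tau + C) by rewrite leq_mul2l c1 orbT.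
  have d2 : q * g tau <= q * (l + C) by rewrite leq_mul2l c2 orbT.
  rewrite !mulnDr in d1 d2.
  by apply: hn1; lia.
pose tau := n1.+1; have u0 : 0 < u tau by rewrite muln_gt0 fact_gt0.
have [Q [eQ dQ aQ dvQ]] := out tau.
have n0 : 0 < 3 * u tau by lia.
have [A eA hA] := area_trapezoid (2 * u tau) (u tau).
have hB := dinv_trapezoid (2 * u tau) (u tau).
rewrite cells_blocks -/(u tau) eA in dvQ; case: dvQ => dvQ.
rewrite cells_blocks -/(u tau) in aQ.
have tot : 2 * (dinv (trapezoid (2 * u tau) (u tau)) + A) = 3 * u tau * (3 * u tau).-1.
  by rewrite mulnDr hA hB; case: (u tau) u0 => // m _; nia.
have [l_range low high] := top_degree_run dQ n0 aQ dvQ tot.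
rewrite hB in low high.
have DQ : D \in Q.
  by rewrite -has_pred1 has_count; case: dQ => _ _ -> _.
have [x [sx lx minx eindex]] := first_descent eQ DQ.
have [d ed vd] := minimal_near_boundary tameN arityK growth sx lx minx.
have [t et] := decodes_surj vd.
pose z : target := Tagged (fun c => (arity c).-tuple (code N 3 K2)) t.
have vz q : q \in decodes (tagged z) -> valid_descriptor N K2 3 q.
  by rewrite [decodes _]et; apply: vd.
have ez : coords N x = attach_blocks tau K2 (decodes (tagged z)).
  by rewrite [decodes _]et.
have := hn1 tau (leqnSn n1) z vz x ez; rewrite /= -eindex => h.
exact: h l_range low high.
Qed.

End Contradiction.

Theorem theorem1p3 :
  ~ exists T : seq step -> option (seq step),
      WRP T /\
      forall (n : nat) (P : seq step), dyck n P ->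
        exists Q : seq step,
          [/\ T P = Some Q, dyck n Q,
              area Q = Posz (dinv P) & Posz (dinv Q) = area P].
Proof.
case=> T [[p eT] swap]; apply: (@swap_contradiction p) => n P dP.
by have [Q [TQ dQ aQ bQ]] := swap n P dP; exists Q; rewrite -eT.
Qed.
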